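(* Let $\phi,\psi\in\mathrm{Sym}(d)$ be a pair of involutions, $\iota=(\phi,\psi)$, and let $M$ be a vertex of the $\iota$-invariant Birkhoff polytope $B_d^\iota$, with associated graph $\Gamma$. There exists a dense subset $U\subseteq U^M_{(\phi,\psi)}$, consisting of pairs $(p,q)$ of monic polynomials with rational coefficients, such that for every $(p,q)\in U$ the polynomial $\Phi_{p,q}(h_M)\in\mathbb{Q}[t]$ is irreducible over $\mathbb{Q}$. In particular, for every $(p,q)\in U$ the algebraic degree of $W_2^2(p,q)$ (the degree of its minimal polynomial over $\mathbb{Q}$) is equal to $\dfrac{(d!)^2}{|\mathrm{Aut}_\iota(\Gamma)|}$.
   Context: Involution here means a permutation whose square is the identity (the identity is allowed). $B_d$ denotes the Birkhoff polytope of $d\times d$ doubly stochastic matrices, and $B_d^\iota=\{M\in B_d: M_{ij}=M_{\phi(i)\psi(j)}\ \forall i,j\}$. Cost and Wasserstein distance: for polynomials $p(z)=\prod_{i=1}^d(z-\alpha_i)$, $q(z)=\prod_{j=1}^d(z-\beta_j)$ without multiple roots and $M\in B_d$, $\mathrm{cost}(M,p,q)=\frac1d\sum_{1\le i,j\le d}M_{ij}\|\alpha_i-\beta_j\|^2$, with $\|\cdot\|$ the Euclidean norm on $\mathbb{C}$, and $W_2^2(p,q)=\min_{M\in B_d}\mathrm{cost}(M,p,q)$. The set $U^M_{(\phi,\psi)}$: the set of pairs $(p,q)$ of monic degree-$d$ polynomials in $\mathbb{R}[z]$ without multiple roots whose roots can be enumerated as $p(z)=\prod_i(z-\alpha_i)$,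 $q(z)=\prod_j(z-\beta_j)$ with $\overline{\alpha_i}=\alpha_{\phi(i)}$, $\overline{\beta_j}=\beta_{\psi(j)}$ for all $i,j$, and so that $M$ is the unique minimizer of $\mathrm{cost}(\cdot,p,q)$ over $B_d^\iota$. It is regarded as a subset of the space of pairs of monic real polynomials of degree $d$, identified with $\mathbb{R}^{2d}$ via coefficients, with the Euclidean topology. Roots of pairs in $U^M_{(\phi,\psi)}$ are always ordered in this way. Graph: every vertex $M$ of $B_d^\iota$ has entries in $\{0,\frac12,1\}$; the associated graph $\Gamma$ is the bipartite multigraph on $[d]\times\{L,R\}$ in which $(i,L)$ and $(j,R)$ are joined by $2M_{ij}$ edges; $\iota$ acts by $\iota(i,L)=(\phi(i),L)$, $\iota(j,R)=(\psi(j),R)$. Group: $G=\mathrm{Sym}(d)\times\mathrm{Sym}(d)$ acts on $[d]\times\{L,R\}$ by $(g_1,g_2)\cdot(i,L)=(g_1(i),L)$, $(g_1,g_2)\cdot(j,R)=(g_2(j),R)$, and on $A=\mathbb{Q}[x_1,\dots,x_d,y_1,\dots,y_d]$ by $(g_1,g_2)\cdot x_i=x_{g_1(i)}$, $(g_1,g_2)\cdot y_j=y_{g_2(j)}$. $\mathrm{Aut}_\iota(\Gamma)$ is the group of automorphisms of $\Gamma$ (permutations of the vertices preserving edge multiplicities) that preserve both sides and commute with $\iota$, viewed as a subgroup of $G$. Polynomials: $f_M=\frac1d\sum_{1\le i,j\le d}M_{ij}(x_i-y_j)(x_{\phi(i)}-y_{\psi(j)})\in A$. The stabilizer of $f_M$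 in $G$ is $\mathrm{Aut}_\iota(\Gamma)$, and $h_M=\prod_{g\in G/\mathrm{Aut}_\iota(\Gamma)}(g(f_M)-t)\in A[t]$ (product over left cosets). $\Phi_{p,q}:A[t]\to\mathbb{C}[t]$ is the $\mathbb{Q}$-algebra homomorphism $x_i\mapsto\alpha_i$, $y_j\mapsto\beta_j$, $t\mapsto t$; since $h_M$ is $G$-invariant, $\Phi_{p,q}(h_M)$ lies in $\mathbb{Q}[t]$ when $p,q\in\mathbb{Q}[z]$. *)

(* Defs.v *)
From HB Require Import structures.
From mathcomp Require Import all_boot all_order all_fingroup all_algebra.
From mathcomp Require Import all_classical all_reals all_analysis.
From mathcomp Require Import complex.
From mathcomp Require mpoly.
(* The notations of mpoly clash with those of mathcomp-analysis. *)
Import -(notations) mpoly.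

Set Implicit Arguments.
Unset Strict Implicit.
Unset Printing Implicit Defensive.

Import Order.TTheory GRing.Theory Num.Theory.
Import numFieldNormedType.Exports.

Local Open Scope ring_scope.

Section Birkhoff.

Local Open Scope classical_set_scope.

Variables (R : realType) (d : nat).
Implicit Types (phi psi : {perm 'I_d}) (M N : 'M[R]_d).

Definition birkhoff : set 'M[R]_d :=
  [set M | [/\ forall i j, 0 <= M i j,
               forall i, \sum_j M i j = 1
             & forall j, \sum_i M i j = 1]].

Definition inv_birkhoff phi psi : set 'M[R]_d :=
  [set M | birkhoff M /\ forall i j, M i j = M (phi i) (psi j)].

Definition is_vertex (P : set 'M[R]_d) M : Prop :=
  P M /\ forall N1 N2 (t : R), P N1 -> P N2 -> 0 < t < 1 ->
    M = t *: N1 + (1 - t) *: N2 -> N1 = M /\ N2 = M.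

Definition cost M (alpha beta : 'I_d -> R[i]) : R :=
  d%:R^-1 * \sum_i \sum_j M i j * Normc.normc (alpha i - beta j) ^+ 2.

(* The infimum is attained: [birkhoff] is compact and nonempty. *)
Definition W2sq (alpha beta : 'I_d -> R[i]) : R :=
  inf [set cost M alpha beta | M in birkhoff].

Definition enumerates_roots (alpha : 'I_d -> R[i]) (p : {poly R}) : Prop :=
  injective alpha /\
  map_poly (real_complex R) p = \prod_i ('X - (alpha i)%:P).

Definition conj_by phi (alpha : 'I_d -> R[i]) : Prop :=
  forall i, conjc (alpha i) = alpha (phi i).

Definition unique_minimizer phi psi M (alpha beta : 'I_d -> R[i]) : Prop :=
  inv_birkhoff phi psi M /\
  forall N, inv_birkhoff phi psi N -> N != M ->
    cost M alpha beta < cost N alpha beta.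

(* The orderings of the roots of (p, q) that witness membership in the set
   U^M_(phi,psi). *)
Definition admissible phi psi M (p q : {poly R}) (alpha beta : 'I_d -> R[i]) :=
  [/\ enumerates_roots alpha p, enumerates_roots beta q,
      conj_by phi alpha, conj_by psi beta
    & unique_minimizer phi psi M alpha beta].

Definition UM phi psi M : set ({poly R} * {poly R}) :=
  [set pq | [/\ pq.1 \is monic, size pq.1 = d.+1,
                pq.2 \is monic, size pq.2 = d.+1
              & exists alpha beta, admissible phi psi M pq.1 pq.2 alpha beta]].

(* Coordinates on pairs of monic polynomials of degree d: the non-leading
   coefficients. *)
Definition coef_pair (pq : {poly R} * {poly R}) : 'rV[R]_(d + d) :=
  row_mx (\row_(i < d) pq.1`_i) (\row_(i < d) pq.2`_i).

Definition dense_in (U V : set ({poly R} * {poly R})) : Prop :=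
  U `<=` V /\ coef_pair @` V `<=` closure (coef_pair @` U).

(* 2 M_ij as a natural number; exact on the vertices of [inv_birkhoff], whose
   entries are 0, 1/2 or 1. *)
Definition mult M (i j : 'I_d) : nat := Num.truncn (2 * M i j).

(* M with entries in the rationals, see [map_ratmx]. *)
Definition ratmx M : 'M[rat]_d := \matrix_(i, j) ((mult M i j)%:R / 2).

Lemma map_ratmx M :
  (forall i j, M i j \in [:: 0; 2^-1; 1]) -> map_mx ratr (ratmx M) = M.
Proof.
move=> hM; apply/matrixP => i j; rewrite !mxE /mult rmorphM fmorphV !rmorph_nat.
have := hM i j; rewrite !inE => /or3P[]/eqP ->.
- by rewrite mulr0 truncn0 mul0r.
- by rewrite divff ?pnatr_eq0// truncn1 mul1r.
- by rewrite mulr1 natrK divff ?pnatr_eq0.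
Qed.

(* Vertices of the graph: [inl i] is (i, L) and [inr j] is (j, R). *)
Definition edges M (u v : 'I_d + 'I_d) : nat :=
  match u, v with
  | inl i, inr j | inr j, inl i => mult M i j
  | _, _ => 0
  end.

End Birkhoff.

Section Group.

Variable d : nat.
Notation G := ({perm 'I_d} * {perm 'I_d})%type.

Definition act_vertex (g : G) (u : 'I_d + 'I_d) : 'I_d + 'I_d :=
  match u with inl i => inl (g.1 i) | inr j => inr (g.2 j) end.

Definition Aut_iota (R : realType) (phi psi : {perm 'I_d}) (M : 'M[R]_d) :
    {set G} :=
  [set g : G |
    [forall u, forall v,
       edges M (act_vertex g u) (act_vertex g v) == edges M u v] &&
    [forall u, act_vertex g (act_vertex (phi, psi) u) ==
               act_vertex (phi, psi) (act_vertex g u)]].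

(* Q[x_1..x_d, y_1..y_d]: the first d variables are x, the last d are y. *)
Definition polyXY := mpoly (d + d) rat.

Definition xv (i : 'I_d) : polyXY := mpolyX rat (mnm1 (lshift d i)).
Definition yv (j : 'I_d) : polyXY := mpolyX rat (mnm1 (rshift d j)).

Definition act_XY (g : G) : polyXY -> polyXY :=
  mmap (@mpolyC (d + d) rat)
    (fun k => match fintype.split k with
              | inl i => xv (g.1 i)
              | inr j => yv (g.2 j)
              end).

Definition f_poly (R : realType) (phi psi : {perm 'I_d}) (M : 'M[R]_d) : polyXY :=
  d%:R^-1 *: \sum_i \sum_j
    ratmx M i j *: ((xv i - yv j) * (xv (phi i) - yv (psi j))).

(* In {perm _} the product is composed left to right, (s * t) i = t (s i), so
   the left cosets g Aut for the usual composition of maps are the right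
   cosets Aut :* g here; [act_XY g (f_poly phi psi M)] only depends on Aut :* g. *)
Definition h_poly (R : realType) (phi psi : {perm 'I_d}) (M : 'M[R]_d) :
    {poly polyXY} :=
  \prod_(C in rcosets (Aut_iota phi psi M) [set: G])
    ((act_XY (repr C) (f_poly phi psi M))%:P - 'X).

Definition Phi (R : realType) (alpha beta : 'I_d -> R[i]) :
    {poly polyXY} -> {poly R[i]} :=
  map_poly (mmap (@ratr R[i])
    (fun k => match fintype.split k with
              | inl i => alpha i
              | inr j => beta j
              end)).

End Group.

Definition is_rational (R : realType) (p : {poly R}) : Prop :=
  exists p0 : {poly rat}, p = map_poly ratr p0.

Definition is_minpoly (R : realType) (w : R) (m : {poly rat}) : Prop :=
  [/\ m \is monic, root (map_poly ratr m) w
    & forall r : {poly rat}, root (map_poly ratr r) w -> m %| r].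

Definition algebraic_degree (R : realType) (w : R) (n : nat) : Prop :=
  exists2 m, is_minpoly w m & size m = n.+1.

(* Main.v *)
Require Import Defs.
From HB Require Import structures.
From mathcomp Require Import all_boot all_order all_fingroup all_algebra.
From mathcomp Require Import cyclic finfield.
From mathcomp Require Import all_classical all_reals all_analysis.
From mathcomp Require Import complex.
From mathcomp Require Import ring lra zify.
From mathcomp Require mpoly.
Import -(notations) mpoly.

Set Implicit Arguments.
Unset Strict Implicit.
Unset Printing Implicit Defensive.

Import Order.TTheory GRing.Theory Num.Theory.
Import numFieldNormedType.Exports.

Local Open Scope ring_scope.

(** Suppose that every algebraic relation over the rationals between the roots of a
    pair [(p, q)] is preserved by all of [G = Sym(d) * Sym(d)], that is, the roots
    of [p] and [q] have Galois group [G]. Then the conjugates of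
    [f_M(alpha, beta)] are all the values [g(f_M)(alpha, beta)]. If moreover these
    values are distinct for distinct cosets of the stabiliser of [f_M], then
    [Phi alpha beta h_M] is, up to sign, the minimal polynomial of
    [f_M(alpha, beta)]. This number is the cost of [M], and averaging a matrix with
    its conjugate by [(phi, psi)] shows that the cost of [M] is the minimum over
    the whole Birkhoff polytope, that is, [W2sq]. The degree is the number of
    cosets, because the stabiliser of [f_M] is [Aut_iota] ([stabilizerP]).

    It remains to show that such pairs are dense in [UM]. Instead of Hilbert's
    irreducibility theorem, the argument uses congruences, which are compatible
    with approximation over the reals. For every [pi] in [G] and every large prime
    [l], there are polynomials modulo [l] on whose roots the [l]-th power map acts
    as [pi] ([frobenius_orbit_points]). Any pair of integral polynomials with this
    reduction has a conjugate of [pi] in its Galois group: this is the existence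
    of Frobenius elements ([frobenius_symmetry]). Its proof here needs neither
    splitting fields nor prime ideals. It rests on the fact that invariant integral
    polynomials take compatible values at the roots over any two rings
    ([invariant_transfer]), which implies that all relations between the complex
    roots hold, after relabelling, between the roots modulo [l]
    ([relations_specialize]). Imposing one congruence for each [pi], the Galois
    group meets every conjugacy class of [G], so it is [G]
    ([conjugates_cover]). One more congruence makes the values on the orbit of
    [f_M] distinct ([forced_separation]). All conditions together form a congruence
    modulo a single [N] ([special_pairs]).

    Given a pair in [UM], dividing by a large integer the roots of integral
    polynomials that satisfy this congruence gives rational polynomials arbitrarily
    close to it ([approx_coefs]). They stay in [UM]: roots move continuously and
    keep their conjugation pattern ([roots_near]), and [M] remains the unique
    minimiser because, by the Birkhoff-von Neumann theorem, only finitely many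
    competitors matter ([minimizer_near]). The same theorem shows that vertices of
    the invariant polytope have entries 0, 1/2 and 1 ([vertex_half]). *)

(** * Evaluation of multivariate polynomials *)

Section MpolyMorphisms.

Variables (n : nat) (A : comNzRingType).
Local Notation XV i := (mpolyX A (mnm1 i)).

(** A ring morphism out of a polynomial ring is determined by its values on
    constants and variables, that is, it is an evaluation. *)
Lemma rmorph_mmapE (B : comNzRingType) (f : {rmorphism mpoly n A -> B}) P :
  f P = mmap (f \o @mpolyC n A) (fun i => f (XV i)) P.
Proof.
rewrite {1}(mpolyE P) raddf_sum; apply: eq_bigr => m _ /=.
rewrite -mul_mpolyC rmorphM; congr (_ * _).
by rewrite mpolyXE_id rmorph_prod; apply: eq_bigr => i _; rewrite rmorphXn.
Qed.

Lemma eq_mmap (B : nzRingType) (f1 f2 : A -> B) (h1 h2 : 'I_n -> B) P :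
  f1 =1 f2 -> h1 =1 h2 -> mmap f1 h1 P = mmap f2 h2 P.
Proof.
by move=> ef eh; apply: eq_bigr => m _; rewrite ef (mmap1_eq _ eh).
Qed.

Lemma rmorph_mmap (B C : comNzRingType) (r : {rmorphism A -> B})
    (s : {rmorphism B -> C}) (h : 'I_n -> B) P :
  s (mmap r h P) = mmap (s \o r) (s \o h) P.
Proof.
rewrite [LHS](rmorph_mmapE (s \o mmap r h)); apply: eq_mmap => x /=.
  by rewrite mmapC.
by rewrite mmapX mmap1U.
Qed.

Lemma mmapXU (B : nzRingType) (r : {rmorphism A -> B}) (h : 'I_n -> B) i :
  mmap r h (XV i) = h i.
Proof. by rewrite mmapX mmap1U. Qed.

Lemma msymC (s : {perm 'I_n}) c : msym s (mpolyC n c) = mpolyC n c :> mpoly n A.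
Proof. exact: mmapC. Qed.

Lemma msymXU (s : {perm 'I_n}) i : msym s (XV i) = XV (s i).
Proof. exact: mmapXU. Qed.

End MpolyMorphisms.

(** * Symmetric polynomials and specialisation of coefficients *)

Section OneBlock.

Variables (n : nat) (A : comNzRingType).
Local Notation XV i := (mpolyX A (mnm1 i)).
Local Notation esyms := [tuple mesym n A i.+1 | i < n].

(** By Viete's formulas this is the value of the elementary symmetric polynomial
    of degree [i.+1] at the roots of a monic [p] of degree [n]; it makes sense
    over the ring of coefficients, before any roots exist. *)
Definition monic_esym (p : {poly A}) (i : 'I_n) : A :=
  (-1) ^+ i.+1 * p`_(n - i.+1).

Lemma monic_esymE (B : idomainType) (r : {rmorphism A -> B}) p (a : 'I_n -> B) i :
  map_poly r p = \prod_i ('X - (a i)%:P) ->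
  r (monic_esym p i) = mmap r a (mesym n A i.+1).
Proof.
move=> rp; rewrite /monic_esym rmorphM rmorphXn rmorphN1 -coef_map rp.
pose cs := [tuple a i | i < n].
have -> : \prod_i ('X - (a i)%:P) = \prod_(c <- cs) ('X - c%:P).
  by rewrite big_tuple; apply: eq_bigr => j _; rewrite tnth_mktuple.
rewrite (mroots_coeff cs (lift ord0 i)) mulrA -exprD addnn -mul2n exprM.
rewrite sqrrN expr1n expr1n mul1r /mesym !raddf_sum /=; apply: eq_bigr => h _.
rewrite !rmorph_prod; apply: eq_bigr => j _ /=.
by rewrite mevalXU mmapX mmap1U tnth_mktuple.
Qed.

Lemma mmap_comp_mpoly (B : comNzRingType) (r : {rmorphism A -> B}) (a : 'I_n -> B)
    Q (t : n.-tuple (mpoly n A)) :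
  mmap r a (comp_mpoly t Q) = mmap r (fun i => mmap r a (tnth t i)) Q.
Proof.
rewrite /comp_mpoly (rmorph_mmap (@mpolyC n A) (mmap r a)).
by apply: eq_mmap => x //=; rewrite mmapC.
Qed.

(** The value at the roots depends only on the coefficients, and does so
    uniformly in the ring [B] in which the roots are taken. *)
Lemma mmap_esym (B : idomainType) (r : {rmorphism A -> B}) p (a : 'I_n -> B) Q :
  map_poly r p = \prod_i ('X - (a i)%:P) ->
  mmap r a (comp_mpoly esyms Q) = r (meval (monic_esym p) Q).
Proof.
move=> rp; rewrite mmap_comp_mpoly /meval (rmorph_mmap idfun r).
by apply: eq_mmap => // i; rewrite /= tnth_mktuple (monic_esymE _ rp).
Qed.

Lemma map_mesym (B : comNzRingType) (r : {rmorphism A -> B}) k :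
  map_mpoly r (mesym n A k) = mesym n B k.
Proof.
by apply/mpolyP => m; rewrite mcoeff_map_mpoly !mcoeff_mesym; apply: rmorph_nat.
Qed.

Lemma map_comp_esyms (B : comNzRingType) (r : {rmorphism A -> B}) Q :
  injective r ->
  map_mpoly r (comp_mpoly esyms Q) =
  comp_mpoly [tuple mesym n B i.+1 | i < n] (map_mpoly r Q).
Proof.
move=> inj_r; rewrite map_mpoly_comp //.
have -> // : [tuple of [seq map_mpoly r q | q <- esyms]] =
             [tuple mesym n B i.+1 | i < n].
by apply: eq_from_tnth => i; rewrite tnth_map !tnth_mktuple map_mesym.
Qed.

Lemma msym_inj s : injective (@msym n A s).
Proof.
move=> P Q eqPQ; rewrite -[P]msym1m -[Q]msym1m -(mulgV s) !msymMm.
by rewrite eqPQ.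
Qed.

End OneBlock.

Section TwoBlocks.

Variable d : nat.
Local Notation G := ({perm 'I_d} * {perm 'I_d})%type.

Definition pt (T : Type) (a b : 'I_d -> T) (k : 'I_(d + d)) : T :=
  match fintype.split k with inl i => a i | inr j => b j end.

Lemma pt_lshift T (a b : 'I_d -> T) i : pt a b (lshift d i) = a i.
Proof. by rewrite /pt (unsplitK (inl i)). Qed.

Lemma pt_rshift T (a b : 'I_d -> T) j : pt a b (rshift d j) = b j.
Proof. by rewrite /pt (unsplitK (inr j)). Qed.

Section Act.

Variable A : comNzRingType.
Local Notation XV i := (mpolyX A (mnm1 i)).

Definition act (g : G) : mpoly (d + d) A -> mpoly (d + d) A :=
  mmap (@mpolyC (d + d) A)
    (pt (fun i => XV (lshift d (g.1 i))) (fun j => XV (rshift d (g.2 j)))).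

HB.instance Definition _ g := GRing.RMorphism.copy (act g) (act g).

Definition act_invariant P := forall g, act g P = P.

(** The second block of variables becomes part of the coefficients, so that the
    theory of symmetric polynomials in one block of variables applies twice. *)
Definition curry_mpoly : mpoly (d + d) A -> mpoly d (mpoly d A) :=
  mmap (@mpolyC d (mpoly d A) \o @mpolyC d A)
    (pt (fun i => mpolyX _ (mnm1 i)) (fun j => mpolyC _ (XV j))).

HB.instance Definition _ := GRing.RMorphism.copy curry_mpoly curry_mpoly.

Lemma curry_mpolyC c : curry_mpoly (mpolyC _ c) = mpolyC _ (mpolyC _ c).
Proof. exact: mmapC. Qed.

Lemma curry_mpolyXl i : curry_mpoly (XV (lshift d i)) = mpolyX _ (mnm1 i).
Proof. by rewrite [LHS]mmapXU pt_lshift. Qed.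

Lemma curry_mpolyXr j : curry_mpoly (XV (rshift d j)) = mpolyC _ (XV j).
Proof. by rewrite [LHS]mmapXU pt_rshift. Qed.

Lemma eq_rmorph_blocks (B : comNzRingType) (f1 f2 : {rmorphism mpoly (d + d) A -> B}) :
  (forall c, f1 (mpolyC _ c) = f2 (mpolyC _ c)) ->
  (forall i, f1 (XV (lshift d i)) = f2 (XV (lshift d i))) ->
  (forall j, f1 (XV (rshift d j)) = f2 (XV (rshift d j))) ->
  f1 =1 f2.
Proof.
move=> eC eX eY P; rewrite (rmorph_mmapE f1) (rmorph_mmapE f2).
apply: eq_mmap => // k; rewrite -(splitK k).
by case: (fintype.split k) => i /=.
Qed.

Lemma mmap_curry (B : comNzRingType) (r : {rmorphism A -> B}) (a b : 'I_d -> B) P :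
  mmap (mmap r b) a (curry_mpoly P) = mmap r (pt a b) P.
Proof.
apply: (@eq_rmorph_blocks _ (mmap (mmap r b) a \o curry_mpoly) (mmap r (pt a b)))
  => [c|i|j] /=.
- by rewrite curry_mpolyC mmapC /= !mmapC.
- by rewrite curry_mpolyXl !mmapXU pt_lshift.
- by rewrite curry_mpolyXr mmapC /= !mmapXU pt_rshift.
Qed.

Lemma actC g c : act g (mpolyC _ c) = mpolyC _ c.
Proof. exact: mmapC. Qed.

Lemma actXl g i : act g (XV (lshift d i)) = XV (lshift d (g.1 i)).
Proof. by rewrite [LHS]mmapXU pt_lshift. Qed.

Lemma actXr g j : act g (XV (rshift d j)) = XV (rshift d (g.2 j)).
Proof. by rewrite [LHS]mmapXU pt_rshift. Qed.

Lemma act1 P : act 1%g P = P.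
Proof.
by apply: (@eq_rmorph_blocks _ (act 1%g) idfun) => [c|i|j] /=;
  rewrite ?actC ?actXl ?actXr ?perm1.
Qed.

(** The action is on the right for the product of permutations, which composes
    from left to right. *)
Lemma actM g h P : act (g * h)%g P = act h (act g P).
Proof.
by apply: (@eq_rmorph_blocks _ (act (g * h)%g) (act h \o act g)) => [c|i|j] /=;
  rewrite ?actC ?actXl ?actXr ?permM.
Qed.

Lemma act_inj u : injective (act u).
Proof. by move=> P Q e; rewrite -[P]act1 -[Q]act1 -(mulgV u) !actM e. Qed.

Lemma act_eq u P Q : (act u P == act u Q) = (P == Q).
Proof. exact: inj_eq (@act_inj u) P Q. Qed.

Lemma mmap_act (B : comNzRingType) (r : {rmorphism A -> B}) (a b : 'I_d -> B) g P :
  mmap r (pt a b) (act g P) = mmap r (pt (a \o g.1) (b \o g.2)) P.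
Proof.
apply: (@eq_rmorph_blocks _ (mmap r (pt a b) \o act g)
  (mmap r (pt (a \o g.1) (b \o g.2)))) => [c|i|j] /=.
- by rewrite actC !mmapC.
- by rewrite actXl !mmapXU !pt_lshift.
- by rewrite actXr !mmapXU !pt_rshift.
Qed.

Lemma curry_act1 s P : curry_mpoly (act (s, 1%g) P) = msym s (curry_mpoly P).
Proof.
apply: (@eq_rmorph_blocks _ (curry_mpoly \o act (s, 1%g)) (msym s \o curry_mpoly))
  => [c|i|j] /=.
- by rewrite actC curry_mpolyC msymC.
- by rewrite actXl !curry_mpolyXl msymXU.
- by rewrite actXr !curry_mpolyXr msymC perm1.
Qed.

Lemma curry_act2 s P :
  curry_mpoly (act (1%g, s) P) = map_mpoly (msym s) (curry_mpoly P).
Proof.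
apply: (@eq_rmorph_blocks _ (curry_mpoly \o act (1%g, s))
  (map_mpoly (msym s) \o curry_mpoly)) => [c|i|j] /=.
- by rewrite actC curry_mpolyC map_mpolyC /= msymC.
- by rewrite actXl !curry_mpolyXl map_mpolyX perm1.
- by rewrite actXr !curry_mpolyXr map_mpolyC /= msymXU.
Qed.

(** An invariant of both blocks of variables is a polynomial in the elementary
    symmetric functions of each block: first in those of the first block, with
    coefficients in the polynomials in the second block; these coefficients are
    again symmetric, because the expression in elementary symmetric polynomials
    is unique. Hence its value at the roots of [p] and [q] is an element [c] of
    the coefficient ring. What matters below is that [c] does not depend on [B]:
    for integral [p] and [q], it links the roots in characteristic zero with
    the roots modulo a prime. *)
Lemma invariant_transfer (p q : {poly A}) S : act_invariant S ->
  exists c : A, forall (B : idomainType) (r : {rmorphism A -> B}) (a b : 'I_d -> B),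
    map_poly r p = \prod_i ('X - (a i)%:P) ->
    map_poly r q = \prod_j ('X - (b j)%:P) ->
    mmap r (pt a b) S = r c.
Proof.
move=> invS.
have /sym_fundamental[Q [defQ _]] : curry_mpoly S \is symmetric.
  by apply/issymP => s; rewrite -curry_act1 invS.
pose p' := map_poly (@mpolyC d A) p; pose S1 := meval (monic_esym p') Q.
have symS1 : S1 \is symmetric.
  apply/issymP => s.
  have Qs : map_mpoly (msym s) Q = Q.
    apply: msym_fundamental_un.
    transitivity (map_mpoly (msym s) (curry_mpoly S)).
      by rewrite -defQ map_comp_esyms //; apply: msym_inj.
    by rewrite -curry_act2 invS defQ.
  rewrite /S1 /meval (rmorph_mmap idfun (msym s)) /=.
  rewrite -[in RHS]Qs /map_mpoly.
  rewrite (rmorph_mmap _ (mmap idfun (monic_esym p'))).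
  apply: eq_mmap => x /=; first by rewrite mmapC.
  rewrite mmapX mmap1U /monic_esym rmorphM rmorphXn rmorphN1 coef_map /=.
  by rewrite /msym mmapC.
have [Q' [defQ' _]] := sym_fundamental symS1.
exists (meval (monic_esym q) Q') => B r a b hp hq.
rewrite -mmap_curry -defQ (@mmap_esym _ _ _ _ p').
  by rewrite -/S1 /= -defQ' (mmap_esym _ hq).
rewrite -map_poly_comp -hp; apply: eq_map_poly => x /=; exact: mmapC.
Qed.

End Act.

End TwoBlocks.

(** * Algebraic relations between roots specialise *)

Section Relations.

Variable d : nat.
Local Notation G := ({perm 'I_d} * {perm 'I_d})%type.

Lemma prod_act_invariant (A : comNzRingType) (P : mpoly (d + d) A) :
  act_invariant (\prod_(g : G) act g P).
Proof.
move=> h; rewrite rmorph_prod /= (reindex_inj (mulIg h^-1%g)) /=.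
by apply: eq_bigr => g _; rewrite -actM mulgKV.
Qed.

Lemma eq_mmap_pt (A : comNzRingType) (B : nzRingType) (r : {rmorphism A -> B})
    (a b a' b' : 'I_d -> B) P :
  a =1 a' -> b =1 b' -> mmap r (pt a b) P = mmap r (pt a' b') P.
Proof.
move=> ea eb; apply: eq_mmap => // k; rewrite /pt.
by case: (fintype.split k).
Qed.

Lemma mmap_pt_polyC (A B : comNzRingType) (r : {rmorphism A -> B}) a b
    (P : mpoly (d + d) A) :
  mmap (map_poly r) (pt (polyC \o a) (polyC \o b)) (map_mpoly polyC P) =
  (mmap r (pt a b) P)%:P.
Proof.
apply: (@eq_rmorph_blocks _ _ _
  (mmap (map_poly r) (pt (polyC \o a) (polyC \o b)) \o map_mpoly polyC)
  (polyC \o mmap r (pt a b))) => [c|i|j] /=.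
- by rewrite map_mpolyC /= !mmapC /= map_polyC.
- by rewrite map_mpolyX !mmapXU !pt_lshift.
- by rewrite map_mpolyX !mmapXU !pt_rshift.
Qed.

Lemma map_map_polyC (A B : comNzRingType) (r : {rmorphism A -> B}) (p : {poly A})
    (a : 'I_d -> B) :
  map_poly r p = \prod_i ('X - (a i)%:P) ->
  map_poly (map_poly r) (map_poly polyC p) = \prod_i ('X - ((a i)%:P)%:P).
Proof.
move=> rp; transitivity (map_poly polyC (map_poly r p)).
  by rewrite -!map_poly_comp; apply: eq_map_poly => c /=; rewrite map_polyC.
rewrite rp rmorph_prod; apply: eq_bigr => i _ /=.
by rewrite rmorphB /= map_polyX map_polyC.
Qed.

(** This replaces the choice of a prime of the splitting field above a prime
    number. If every ordering [t] of the roots in [k] violated some relation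
    [S t] that holds over [K], then the norm over the group of the combination
    of all the [S t], with the powers of a new variable as weights, would be
    invariant. It vanishes over [K], hence over [k] as well by
    [invariant_transfer]; so one of its factors vanishes over [k], and so does
    each coefficient of this factor. *)
Lemma relations_specialize (K k : idomainType) (p q : {poly int})
    (a b : 'I_d -> K) (a' b' : 'I_d -> k) :
  injective (intr : int -> K) ->
  map_poly intr p = \prod_i ('X - (a i)%:P) ->
  map_poly intr q = \prod_j ('X - (b j)%:P) ->
  map_poly intr p = \prod_i ('X - (a' i)%:P) ->
  map_poly intr q = \prod_j ('X - (b' j)%:P) ->
  exists t : G, forall S : mpoly (d + d) int,
    mmap intr (pt a b) S = 0 -> mmap intr (pt (a' \o t.1) (b' \o t.2)) S = 0.
Proof.
move=> injK pa qb pa' qb'; apply: contrapT => noneg.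
have /choice[S Sbad] (t : G) : exists S : mpoly (d + d) int, mmap intr (pt a b) S = 0 /\
    mmap intr (pt (a' \o t.1) (b' \o t.2)) S != 0.
  apply: contrapT => nS; apply: noneg; exists t => S S0; apply/eqP.
  by apply/negPn/negP => St; apply: nS; exists S.
pose T := \sum_(t : G)
  (mpolyC (d + d) 'X^(enum_rank t)) * map_mpoly polyC (S t).
have evT (B : comNzRingType) (x y : 'I_d -> B) :
    mmap (map_poly intr) (pt (polyC \o x) (polyC \o y)) T =
    \sum_(t : G) 'X^(enum_rank t) * (mmap intr (pt x y) (S t))%:P.
  rewrite raddf_sum; apply: eq_bigr => t _ /=.
  by rewrite rmorphM /= mmapC /= map_polyXn mmap_pt_polyC.
have [c ctr] := invariant_transfer (map_poly polyC p) (map_poly polyC q)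
  (prod_act_invariant T).
have c0 : map_poly intr c = 0 :> {poly K}.
  rewrite -(ctr _ (map_poly intr) (polyC \o a) (polyC \o b)); first last.
  - exact: map_map_polyC.
  - exact: map_map_polyC.
  rewrite rmorph_prod (bigD1 1%g) //= act1 evT big1 ?mul0r // => t _.
  by rewrite (Sbad t).1 mulr0.
have {c0}c0 : c = 0.
  by apply: (map_inj_poly injK) => //; rewrite c0 rmorph0.
have := ctr _ (map_poly intr) (polyC \o a') (polyC \o b').
rewrite c0 rmorph0 => /(_ (map_map_polyC pa') (map_map_polyC qb')).
rewrite rmorph_prod => /eqP/prodf_eq0[/= t _].
rewrite mmap_act => /eqP /(congr1 (fun u : {poly k} => u`_(enum_rank t))).
rewrite (@eq_mmap_pt _ _ _ _ _ (polyC \o (a' \o t.1)) (polyC \o (b' \o t.2))) //.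
rewrite evT coef_sum (bigD1 t) //= coefXnM ltnn subnn coefC eqxx coef0 big1.
  by rewrite addr0 => St; have := (Sbad t).2; rewrite St eqxx.
move=> u ut; rewrite coefXnM; case: ltnP => // le_ut; rewrite coefC subn_eq0.
case: leqP => // le_tu; case/eqP: ut; apply: enum_rank_inj; apply/val_inj/eqP.
by rewrite eqn_leq le_ut le_tu.
Qed.

End Relations.

(** * Frobenius elements *)

Section FrobeniusElements.

Variable d : nat.
Local Notation G := ({perm 'I_d} * {perm 'I_d})%type.

(** The permutations of the roots that come from the Galois group of the splitting
    field over the rationals, described without reference to that field. *)
Definition rational_symmetry (K : numFieldType) (a b : 'I_d -> K) (g : G) :=
  forall S : mpoly (d + d) rat, mmap ratr (pt a b) S = 0 ->
    mmap ratr (pt (a \o g.1) (b \o g.2)) S = 0.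

Lemma min_annihilator (F L : fieldType) (r : {rmorphism F -> L}) (w : L) (R : {poly F}) :
  R != 0 -> root (map_poly r R) w ->
  exists m : {poly F}, [/\ m != 0, root (map_poly r m) w
    & forall s, root (map_poly r s) w -> m %| s].
Proof.
move=> R0 Rw.
pose good n := `[< exists2 m : {poly F}, m != 0 & root (map_poly r m) w /\ size m = n >].
have exg : exists n, good n by exists (size R); apply/asboolP; exists R.
case: (ex_minnP exg) => n /asboolP[m m0 [mw sm]] nmin.
exists m; split => // s sw; rewrite /dvdp.
apply/negPn/negP => smod; have : good (size (s %% m)).
  apply/asboolP; exists (s %% m) => //; split => //.
  have := divp_eq s m => /(congr1 (map_poly r)).
  rewrite rmorphD rmorphM /= => /(congr1 (fun u => u.[w])).
  by rewrite hornerD hornerM (rootP sw) (rootP mw) mulr0 add0r => /esym/rootP.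
by move/nmin; rewrite leqNgt -sm ltn_modp m0.
Qed.

Lemma mmap_map_mpoly n (A B C : comNzRingType) (s : {rmorphism A -> B})
    (r : {rmorphism B -> C}) (h : 'I_n -> C) (P : mpoly n A) :
  mmap r h (map_mpoly s P) = mmap (r \o s) h P.
Proof.
rewrite [LHS](rmorph_mmapE (mmap r h \o map_mpoly s)); apply: eq_mmap => x /=.
  by rewrite map_mpolyC mmapC.
by rewrite map_mpolyX mmapXU.
Qed.

Lemma mmap_ratr_int n (K : numFieldType) (h : 'I_n -> K) (P : mpoly n int) :
  mmap ratr h (map_mpoly intr P) = mmap intr h P.
Proof. by rewrite mmap_map_mpoly; apply: eq_mmap => // c /=; rewrite ratr_int. Qed.

Lemma mmap_horner n (A B : comNzRingType) (r : {rmorphism A -> B}) (x : 'I_n -> B)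
    (m : {poly A}) (P : mpoly n A) :
  mmap r x (map_poly (@mpolyC n A) m).[P] = (map_poly r m).[mmap r x P].
Proof.
rewrite -horner_map /= -map_poly_comp; congr (_.[_]).
by apply: eq_map_poly => c /=; rewrite mmapC.
Qed.

Lemma root_prod_XsubC_mem (B : idomainType) (I : finType) (F : I -> B) i :
  root (\prod_j ('X - (F j)%:P)) (F i).
Proof.
apply/rootP; rewrite horner_prod; apply/eqP/prodf_eq0; exists i => //.
by rewrite hornerXsubC subrr.
Qed.

Lemma root_cofactor_neq0 (B : idomainType) (I : finType) (F : I -> B) i
    (u v : {poly B}) :
  injective F -> u * ('X - (F i)%:P) * v = \prod_j ('X - (F j)%:P) ->
  v.[F i] != 0.
Proof.
move=> injF; rewrite (bigD1 i) //= mulrAC mulrC.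
move/(mulfI (negbT (polyXsubC_eq0 _)))/(congr1 (fun w : {poly B} => w.[F i])).
rewrite hornerM horner_prod => uv; apply/eqP => v0; move: uv.
rewrite v0 mulr0 => /esym/eqP/prodf_eq0[j ji].
by rewrite hornerXsubC subr_eq0 => /eqP/injF/esym/eqP; rewrite (negPf ji).
Qed.

Section Resolvent.

Variables (p q : {poly int}) (th : mpoly (d + d) int).

(** When [th] takes distinct values on the orbit of the roots, it plays the role
    of a primitive element; this is the polynomial whose roots are its
    conjugates under the whole group. *)
Lemma resolventE : exists Rs : {poly int},
  forall (B : idomainType) (x y : 'I_d -> B),
    map_poly intr p = \prod_i ('X - (x i)%:P) ->
    map_poly intr q = \prod_j ('X - (y j)%:P) ->
    map_poly intr Rs = \prod_(g : G) ('X - (mmap intr (pt x y) (act g th))%:P).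
Proof.
pose T := mpolyC (d + d) 'X - map_mpoly polyC th.
have [c ctr] := invariant_transfer (map_poly polyC p) (map_poly polyC q)
  (prod_act_invariant T).
exists c => B x y px qy.
rewrite -(ctr _ (map_poly intr) _ _ (map_map_polyC px) (map_map_polyC qy)).
rewrite rmorph_prod; apply: eq_bigr => g _ /=.
rewrite !mmap_act rmorphB /= mmapC /= map_polyX; congr ('X - _).
by rewrite -mmap_pt_polyC; apply: eq_mmap_pt.
Qed.

(** Lagrange interpolation: [La] divided by the derivative of the resolvent is the
    polynomial that expresses each value of [S] on the orbit through the value
    of the primitive element [th] at the same point. It has rational
    coefficients because the sum that defines it is invariant. *)
Lemma lagrangeE (S : mpoly (d + d) rat) : exists La : {poly rat},
  forall (K : numFieldType) (x y : 'I_d -> K),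
    map_poly intr p = \prod_i ('X - (x i)%:P) ->
    map_poly intr q = \prod_j ('X - (y j)%:P) ->
    forall u : G,
    (map_poly ratr La).[mmap intr (pt x y) (act u th)] =
    mmap ratr (pt x y) (act u S) * \prod_(h : G | h != 1%g)
      (mmap intr (pt x y) (act u th) - mmap intr (pt x y) (act (h * u)%g th)).
Proof.
pose thq := map_mpoly polyC (map_mpoly intr th) : mpoly (d + d) {poly rat}.
pose T := map_mpoly polyC S * \prod_(h : G | h != 1%g) (mpolyC _ 'X - act h thq).
pose La := \sum_(g : G) act g T.
have invLa : act_invariant La.
  move=> h; rewrite raddf_sum /= (reindex_inj (mulIg h^-1%g)) /=.
  by apply: eq_bigr => g _; rewrite -actM mulgKV.
have [c ctr] := invariant_transfer (map_poly polyC (map_poly intr p))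
  (map_poly polyC (map_poly intr q)) invLa.
exists c => K x y px qy u.
have ratr_intp (s : {poly int}) : map_poly ratr (map_poly intr s) = map_poly intr s :> {poly K}.
  by rewrite -map_poly_comp; apply: eq_map_poly => i /=; rewrite ratr_int.
rewrite -(ctr _ (map_poly ratr) (polyC \o x) (polyC \o y)); first last.
- by apply: map_map_polyC; rewrite ratr_intp.
- by apply: map_map_polyC; rewrite ratr_intp.
have evth h : mmap (map_poly ratr) (pt (polyC \o x) (polyC \o y)) (act h thq) =
    (mmap intr (pt x y) (act h th))%:P.
  rewrite mmap_act (@eq_mmap_pt _ _ _ _ _ _ (polyC \o (x \o h.1)) (polyC \o (y \o h.2))) //.
  by rewrite mmap_pt_polyC mmap_ratr_int mmap_act.
have evS h : mmap (map_poly ratr) (pt (polyC \o x) (polyC \o y)) (act h (map_mpoly polyC S)) =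
    (mmap ratr (pt x y) (act h S))%:P.
  rewrite mmap_act (@eq_mmap_pt _ _ _ _ _ _ (polyC \o (x \o h.1)) (polyC \o (y \o h.2))) //.
  by rewrite mmap_pt_polyC mmap_act.
have evT g : mmap (map_poly ratr) (pt (polyC \o x) (polyC \o y)) (act g T) =
    (mmap ratr (pt x y) (act g S))%:P * \prod_(h : G | h != 1%g)
      ('X - (mmap intr (pt x y) (act (h * g)%g th))%:P).
  rewrite rmorphM rmorphM /= evS; congr (_ * _).
  rewrite !rmorph_prod; apply: eq_bigr => h _ /=.
  by rewrite !rmorphB /= actC mmapC /= map_polyX -actM evth.
rewrite raddf_sum /=; under eq_bigr do rewrite evT.
rewrite (bigD1 u) //= hornerD hornerM hornerC horner_prod.
rewrite [X in _ + X](_ : _ = 0) ?addr0.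
  by congr (_ * _); apply: eq_bigr => h _; rewrite hornerXsubC.
rewrite horner_sum big1 // => g gu; rewrite hornerM hornerC horner_prod.
apply/eqP; rewrite mulf_eq0; apply/orP; right; apply/prodf_eq0.
exists (u * g^-1)%g.
  by apply: contra gu => /eqP e; rewrite -(mulgKV g u) e mul1g.
by rewrite mulgKV hornerXsubC subrr.
Qed.

End Resolvent.

Lemma perm_root_prod (B : comNzRingType) (p : {poly int}) (x : 'I_d -> B) (s : {perm 'I_d}) :
  map_poly intr p = \prod_i ('X - (x i)%:P) ->
  map_poly intr p = \prod_i ('X - ((x \o s) i)%:P).
Proof. by move=> ->; rewrite (reindex_inj (@perm_inj _ s)). Qed.

(** The existence of Frobenius elements, after van der Waerden. Let [m] be the
    minimal polynomial of the value of the primitive element [th] at the roots.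
    By Gauss's lemma, the resolvent is a product [m1 * m2] over the integers,
    with [m1] proportional to [m]. After a relabelling of the roots in [k], all
    relations over [K] hold over [k]. The [l]-th power map sends a root of [m1]
    in [k] to a root of [m1], and it acts on the roots by [s]. If [s] did not
    send the root of [m1] in [K] to a root of [m1], it would send it to a root
    of [m2]; then the resolvent would have a double root in [k]. Hence [m]
    vanishes at the conjugate by [s], and with it every interpolation polynomial
    of a relation. *)
Lemma frobenius_symmetry (K : numFieldType) (k : fieldType) (l : nat)
    (p q : {poly int}) (th : mpoly (d + d) int)
    (a b : 'I_d -> K) (a' b' : 'I_d -> k) (pi : G) :
  l \in [pchar k] ->
  map_poly intr p = \prod_i ('X - (a i)%:P) ->
  map_poly intr q = \prod_j ('X - (b j)%:P) ->
  map_poly intr p = \prod_i ('X - (a' i)%:P) ->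
  map_poly intr q = \prod_j ('X - (b' j)%:P) ->
  (forall i, a' (pi.1 i) = a' i ^+ l) -> (forall j, b' (pi.2 j) = b' j ^+ l) ->
  injective (fun g : G => mmap intr (pt a' b') (act g th)) ->
  exists t : G, rational_symmetry a b (pi ^ t)%g.
Proof.
move=> lk pa qb pa' qb' pia pib inj_th.
have [t spec] := relations_specialize (@intr_inj K) pa qb pa' qb'.
exists t^-1%g => S S0; set s := (pi ^ t^-1)%g.
have {}pa' := perm_root_prod t.1 pa'; have {}qb' := perm_root_prod t.2 qb'.
set x := a' \o t.1 in spec pa'; set y := b' \o t.2 in spec qb'.
have sE : s = (t.1 * pi.1 * t.1^-1, t.2 * pi.2 * t.2^-1)%g.
  by rewrite /s conjgE invgK mulgA.
clearbody s.
have sx i : x (s.1 i) = x i ^+ l.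
  by rewrite /x /= -pia sE !permM permKV.
have sy j : y (s.2 j) = y j ^+ l.
  by rewrite /y /= -pib sE !permM permKV.
have thx g : mmap intr (pt x y) (act g th) = mmap intr (pt a' b') (act (g * t)%g th).
  by rewrite actM [RHS]mmap_act.
have inj_thx : injective (fun g : G => mmap intr (pt x y) (act g th)).
  move=> g h e.
  exact: mulIg (inj_th _ _ (etrans (esym (thx g)) (etrans e (thx h)))).
pose thK g := mmap intr (pt a b) (act g th).
pose thk g := mmap intr (pt x y) (act g th).
(* The Frobenius endomorphism of [k] acts on the point as [s] does. *)
have frob : thk s = thk 1%g ^+ l.
  rewrite -[RHS](pFrobenius_autE lk).
  rewrite /thk act1 mmap_act (rmorph_mmap _ (pFrobenius_aut lk)).
  apply: eq_mmap => [c|i] /=; first by rewrite rmorph_int.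
  by rewrite pFrobenius_autE /pt; case: (fintype.split i) => j /=; rewrite ?sx ?sy.
have [Rs RsE] := resolventE p q th.
have RK := RsE _ _ _ pa qb; have Rk := RsE _ _ _ pa' qb'.
have RKthK g : root (map_poly intr Rs) (thK g).
  by rewrite RK; apply: (root_prod_XsubC_mem thK).
have ratr_intp (u : {poly int}) : map_poly ratr (map_poly intr u) = map_poly intr u :> {poly K}.
  by rewrite -map_poly_comp; apply: eq_map_poly => i /=; rewrite ratr_int.
have Rs0 : Rs != 0.
  have : map_poly intr Rs \is @monic K by rewrite RK; apply: monic_prod_XsubC.
  by move/monic_neq0; apply: contraNneq => ->; rewrite rmorph0.
have [||m [m0 mw mmin]] := @min_annihilator _ _ (@ratr K) (thK 1%g) (map_poly intr Rs).
- by rewrite -size_poly_eq0 size_rat_int_poly size_poly_eq0.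
- by rewrite ratr_intp.
have : m %| map_poly intr Rs by apply: mmin; rewrite ratr_intp.
move=> /dvdpP_rat_int[m1 [e e0 mE] [m2 Rs12]].
have m1root (z : K) : root (map_poly intr m1) z = root (map_poly ratr m) z.
  by rewrite mE map_polyZ /= ratr_intp rootZ // fmorph_eq0.
have spec_horner (u : {poly int}) g : root (map_poly intr u) (thK g) -> root (map_poly intr u) (thk g).
  move/rootP; rewrite -mmap_horner => /spec; rewrite mmap_horner => u0.
  by apply/rootP.
(* [m1] has coefficients in the prime field. *)
have m1k : root (map_poly intr m1) (thk s).
  have: root (map_poly intr m1) (thk 1%g) by apply: spec_horner; rewrite m1root.
  rewrite frob => /rootP m10; apply/rootP.
  rewrite -[_ ^+ l](pFrobenius_autE lk).
  have -> : map_poly intr m1 = map_poly (pFrobenius_aut lk) (map_poly intr m1).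
    by rewrite -map_poly_comp; apply: eq_map_poly => c /=; rewrite rmorph_int.
  by rewrite horner_map /= m10 rmorph0.
have mths : root (map_poly ratr m) (thK s).
  rewrite -m1root; apply: contraT => m1s.
  have : root (map_poly intr m2) (thK s).
    by have := RKthK s; rewrite Rs12 rmorphM rootM (negPf m1s).
  move/spec_horner => m2k; move: Rk; rewrite Rs12 rmorphM /=.
  have /factor_theorem[n1 ->] := m1k.
  move=> RskE; have /eqP := root_cofactor_neq0 inj_thx RskE.
  by case; apply/rootP.
have [La LaE] := lagrangeE p q th S.
have := LaE _ _ _ pa qb 1%g; rewrite (act1 S) S0 mul0r => /rootP/mmin mLa.
have : (map_poly ratr La).[thK s] = 0.
  apply/rootP; move: mths; rewrite -!dvdp_XsubCl => /dvdp_trans; apply.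
  by rewrite dvdp_map.
rewrite (LaE _ _ _ pa qb) => /eqP; rewrite mulf_eq0 => /orP[|].
  by rewrite mmap_act => /eqP.
rewrite prodf_seq_eq0 => /hasP[h _ /andP[h1]].
rewrite -rmorphB /= => /eqP/spec; rewrite rmorphB => /eqP.
rewrite subr_eq0 => /eqP/inj_thx/esym/eqP.
by rewrite -{2}[s]mul1g (inj_eq (mulIg s)) (negPf h1).
Qed.

End FrobeniusElements.

(** * Permutations realised as Frobenius over a finite field *)

Section ConjugatesCover.

Local Open Scope group_scope.

(** Jordan: a proper subgroup has too few conjugates to cover the group, since they
    all share the identity. *)
Lemma conjugates_cover (gT : finGroupType) (H : {group gT}) :
  (forall x, exists t, x ^ t \in H) -> H = [set: gT] :> {set gT}.
Proof.
move=> meetH; apply/eqP; rewrite eqEcard finset.subsetT /=.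
have sub : [set: gT]^# \subset \bigcup_(K in H :^: [set: gT]) (K^#).
  apply/fintype.subsetP => x; rewrite !inE andbT => x1; have [t xt] := meetH x.
  apply/bigcupP; exists (H :^ t^-1); first by apply: mem_orbit; rewrite inE.
  by rewrite !inE x1 mem_conjgV.
have cardsub : (#|\bigcup_(K in H :^: [set: gT]) (K^#)| <=
    #|[set: gT] : H| * #|H|.-1)%N.
  apply: (@leq_trans (\sum_(K in H :^: [set: gT]) #|H|.-1)).
    apply: (@leq_trans (\sum_(K in H :^: [set: gT]) #|(K^#)|)).
      elim/big_rec2: _ => [|K m A _ le_Am]; first by rewrite cards0.
      by rewrite (leq_trans (leq_card_setU _ _)) // leq_add2l.
    apply: leq_sum => _ /imsetP[x _ ->]; rewrite -(cardJg H x).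
    by rewrite [X in (_ <= X.-1)%N](cardsD1 1%g) group1.
  rewrite sum_nat_const card_conjugates leq_mul2r; apply/orP; right.
  apply: dvdn_leq (indexg_gt0 _ _) (indexgS _ _).
  by rewrite finset.subsetI finset.subsetT normG.
have := leq_trans (subset_leq_card sub) cardsub.
have := Lagrange (finset.subsetT H); rewrite /= => defT.
have := cardsD1 1 [set: gT]; rewrite inE /= => cT.
have := cardG_gt0 H; have := indexg_gt0 [set: gT] H.
have -> : #|[set: gT] :\ 1| = #|[set: gT]|.-1 by rewrite cT add1n.
rewrite -defT; move: #|H| #|_ : _| => h i; nia.
Qed.

End ConjugatesCover.

Lemma avoid_roots (k : idomainType) (I : finType) (P : pred I) (F : I -> {poly k})
    (m : nat) (S : seq k) :
  uniq S -> (#|I| * m < size S)%N ->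
  (forall i, P i -> F i != 0) -> (forall i, P i -> (size (F i) <= m.+1)%N) ->
  exists2 s, s \in S & forall i, P i -> (F i).[s] != 0.
Proof.
move=> uS big F0 sF; pose Q := \prod_(i | P i) F i.
have Q0 : Q != 0 by rewrite prodf_seq_neq0; apply/allP => i _; apply/implyP/F0.
have sQ : (size Q <= (#|I| * m).+1)%N.
  apply: leq_trans (size_prod_leq _ _) _.
  rewrite leq_subLR addnS ltnS; apply: leq_trans (_ : \sum_(i | P i) m.+1 <= _)%N.
    exact: leq_sum.
  rewrite sum_nat_const mulnS leq_add2l leq_mul2r; apply/orP; right.
  exact: max_card.
have /allPn[s sS Qs] : ~~ all (root Q) S.
  apply/negP => allS; have := max_poly_roots Q0 allS uS.
  by rewrite ltnNge (leq_trans sQ).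
exists s => // i Pi; apply: contra Qs => /eqP Fs; apply/rootP.
by rewrite horner_prod (bigD1 i) //= Fs mul0r.
Qed.

Lemma char_natr_uniq (k : nzRingType) (l : nat) : l \in [pchar k] ->
  uniq [seq c%:R : k | c <- iota 0 l].
Proof.
move=> lk; rewrite map_inj_in_uniq ?iota_uniq // => c e.
rewrite !mem_iota !add0n /= => lt_cl lt_el.
wlog le_ce : c e lt_cl lt_el / (c <= e)%N.
  by move=> W ce; case/orP: (leq_total c e) => /W ->.
move/esym/eqP; rewrite -subr_eq0 -natrB // -(dvdn_pcharf lk).
rewrite /dvdn modn_small ?(leq_ltn_trans (leq_subr _ _)) // subn_eq0 => le_ec.
by apply/eqP; rewrite eqn_leq le_ce le_ec.
Qed.

(** The [l] elements of the prime field already exhaust the roots of ['X^l - 'X]. *)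
Lemma frobenius_fixed_int (k : fieldType) (l : nat) (u : k) : l \in [pchar k] ->
  u ^+ l = u -> exists c : int, u = c%:~R.
Proof.
move=> lk ul; apply: contrapT => nu.
have l_prime := pcharf_prime lk; have l_gt1 := prime_gt1 l_prime.
have sX : size ('X^l - 'X : {poly k}) = l.+1.
  by rewrite size_polyDl size_polyXn // size_polyN size_polyX ltnS.
have X0 : ('X^l - 'X : {poly k}) != 0 by rewrite -size_poly_eq0 sX.
have := max_poly_roots X0 (rs := u :: [seq c%:R : k | c <- iota 0 l]).
rewrite sX /= size_map size_iota ltnn => H; suff : false by []; apply: H.
  rewrite rootE !hornerE ul subrr eqxx /=; apply/allP => v /mapP[c _ ->].
  rewrite rootE !hornerE -(pFrobenius_autE lk) rmorph_nat subrr //.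
rewrite char_natr_uniq // andbT; apply/negP => /mapP[c _ uc]; apply: nu.
by exists c%:Z.
Qed.

(** Averaging along the orbits of [s] makes any labelling equivariant: if [u] is
    any element of [k], the sum over [j < n] of the [l ^ j]-th powers of
    [u ^+ (((s ^+ j)^-1 i).+1)] defines a point with the required property. Its
    coordinates are polynomials in [u] of degree at most [d * l ^ n.-1] that
    differ in a coefficient of degree at most [d], so some [u] separates them
    when [l] is large. *)
Lemma frobenius_orbit_points (d n l : nat) (k : finFieldType) (s : {perm 'I_d}) :
  l \in [pchar k] -> #|k| = (l ^ n)%N -> (0 < n)%N -> (s ^+ n = 1)%g ->
  (d * d * d < l)%N ->
  exists2 a : 'I_d -> k, injective a & forall i, a (s i) = a i ^+ l.
Proof.
move=> lk cardk n0 sn big.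
have l_prime := pcharf_prime lk; have l_gt1 := prime_gt1 l_prime.
have [d0|d_gt0] := posnP d.
  by exists (fun=> 0) => [i|i]; exfalso; case: i => i; rewrite d0.
have dl : (d < l)%N by apply: leq_trans big; rewrite ltnS -mulnA leq_pmulr // muln_gt0 d_gt0.
pose E (i : 'I_d) j := (((s ^+ j)^-1 i)%g.+1 * l ^ j)%N.
pose F i : {poly k} := \sum_(j < n) 'X^(E i j).
have sF i : (size (F i) <= (d * l ^ n.-1).+1)%N.
  apply: (leq_trans (size_sum _ _ _)); apply/bigmax_leqP => j _.
  rewrite size_polyXn ltnS /E leq_mul // leq_exp2l //.
  by rewrite -ltnS prednK.
have F1 (i i' : 'I_d) : (F i)`_i'.+1 = (i == i')%:R.
  rewrite /F -(prednK n0) big_ord_recl coefD coefXn /E expg0 invg1 perm1 expn0 muln1.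
  rewrite eqSS eq_sym -val_eqE coef_sum big1 ?addr0 // => j _.
  rewrite coefXn; case: eqP => // e; suff : false by [].
  have : (l <= i'.+1)%N.
    by rewrite e (leq_trans _ (leq_pmull _ _)) // -{1}(expn1 l) leq_exp2l.
  by rewrite leqNgt (leq_ltn_trans _ dl).
have [||||u _ Fu] := @avoid_roots k ('I_d * 'I_d)%type (fun ij => ij.1 != ij.2)
  (fun ij => F ij.1 - F ij.2) (d * l ^ n.-1) (enum k).
- exact: enum_uniq.
- rewrite card_prod card_ord -cardE cardk -[in ltnRHS](prednK n0) expnS mulnA.
  by rewrite ltn_mul2r expn_gt0 prime_gt0.
- move=> [i i'] /= ii'; apply/eqP => /(congr1 (fun P : {poly k} => P`_i.+1)).
  rewrite coefB !F1 eqxx coef0 [i' == i]eq_sym (negPf ii') subr0 => /eqP.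
  by rewrite oner_eq0.
- move=> [i i'] _ /=; rewrite (leq_trans (size_polyD _ _)) // size_polyN geq_max.
  by rewrite !sF.
exists (fun i => (F i).[u]) => [i i' eqF|i].
  apply/eqP/negPn/negP => ii'; have := Fu (i, i') ii'.
  by rewrite hornerD hornerN eqF subrr eqxx.
rewrite -(pFrobenius_autE lk) !horner_sum rmorph_sum /=.
pose D j := u ^+ (E (s i) j).
have DE j : D j.+1 = pFrobenius_aut lk ('X^(E i j)).[u].
  rewrite pFrobenius_autE hornerXn -exprM /D /E expgSr invMg permM permK expnSr mulnA //.
have Dn : D n = D 0%N.
  rewrite /D /E sn expg0 expn0 muln1 exprM -cardk.
  by rewrite expf_card.
transitivity (\sum_(j < n) D j); first by apply: eq_bigr => j _; rewrite hornerXn.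
transitivity (\sum_(j < n) D j.+1); last by apply: eq_bigr => j _; rewrite DE.
rewrite -(prednK n0) big_ord_recl big_ord_recr /= prednK // Dn addrC.
by congr (_ + _).
Qed.

(** * Congruence conditions that force symmetries *)

Section SpecialPairs.

Variable d : nat.
Local Notation G := ({perm 'I_d} * {perm 'I_d})%type.
Local Notation XV A i := (mpolyX A (mnm1 i)).

(** A linear form with coefficients the powers of an integer [c]: there are fewer
    than [l] bad values of [c] modulo [l]. *)
Lemma separating_form (k : fieldType) (l : nat) (a b : 'I_d -> k) :
  l \in [pchar k] -> injective a -> injective b ->
  (#|{: G * G}| * (d + d) < l)%N ->
  exists th : mpoly (d + d) int,
    injective (fun g : G => mmap intr (pt a b) (act g th)).
Proof.
move=> lk inja injb big.
pose v (g : G) := pt (a \o g.1) (b \o g.2).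
pose F (g h : G) : {poly k} := \sum_(i < d + d) (v g i - v h i) *: 'X^i.
have coefF g h (i : 'I_(d + d)) : (F g h)`_i = v g i - v h i.
  rewrite coef_sum (bigD1 i) //= coefZ coefXn eqxx mulr1 big1 ?addr0 // => j ji.
  by rewrite coefZ coefXn eq_sym (inj_eq val_inj) (negPf ji) mulr0.
have [||||s /mapP[c _ ->] Fs] := @avoid_roots k (G * G)%type
  (fun gh => gh.1 != gh.2) (fun gh => F gh.1 gh.2) (d + d)
  [seq c%:R : k | c <- iota 0 l].
- exact: char_natr_uniq.
- by rewrite size_map size_iota.
- move=> [g h] /= gh; apply: contra gh => /eqP F0.
  have vgh i : v g i = v h i by apply/eqP; rewrite -subr_eq0 -coefF F0 coef0.
  apply/eqP; rewrite [g]surjective_pairing [h]surjective_pairing; congr (_, _).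
    apply/permP => i; apply: inja.
    by have := vgh (lshift d i); rewrite /v !pt_lshift.
  apply/permP => j; apply: injb.
  by have := vgh (rshift d j); rewrite /v !pt_rshift.
- move=> [g h] _ /=; apply: (leq_trans (size_sum _ _ _)).
  apply/bigmax_leqP => i _; apply: (leq_trans (size_scale_leq _ _)).
  by rewrite size_polyXn ltnS ltnW.
pose th : mpoly (d + d) int := \sum_(i < d + d) mpolyC _ (c%:Z ^+ i) * XV int i.
have thE g : mmap intr (pt a b) (act g th) = \sum_(i < d + d) v g i * c%:R ^+ i.
  rewrite mmap_act /th rmorph_sum; apply: eq_bigr => i _ /=.
  rewrite rmorphM /= mmapC mmapXU mulrC; congr (_ * _).
  exact: (rmorphXn (intmul (1 : k))).
exists th => g h e; have egh := etrans (esym (thE g)) (etrans e (thE h)).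
apply/eqP/negPn/negP => gh.
have := Fs (g, h) gh; rewrite /F horner_sum => /eqP; apply.
under eq_bigr do rewrite hornerZ hornerXn mulrBl.
by rewrite sumrB egh subrr.
Qed.

Definition monic_deg (A : nzRingType) (P : {poly A}) := P \is monic /\ size P = d.+1.

Lemma monic_deg_exists (A : nzRingType) (f : nat -> A) :
  exists2 P, monic_deg P & forall i, (i < d)%N -> P`_i = f i.
Proof.
exists (\poly_(i < d) f i + 'X^d) => [|i lt_id].
  have sP : (size (\poly_(i < d) f i) < d.+1)%N by rewrite ltnS size_poly.
  split; last by rewrite addrC size_polyDl size_polyXn.
  by rewrite monicE addrC lead_coefDl ?size_polyXn // lead_coefXn.
by rewrite coefD coef_poly lt_id coefXn ltn_eqF // addr0.
Qed.

Lemma monic_deg_coef (A : nzRingType) (P : {poly A}) i : monic_deg P -> (d <= i)%N ->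
  P`_i = (i == d)%:R.
Proof.
move=> [mP sP]; rewrite leq_eqVlt => /predU1P[<-|lt_di].
  by rewrite eqxx -[d]/(d.+1.-1) -sP -lead_coefE (monicP mP).
by rewrite nth_default ?sP // gtn_eqF.
Qed.

Lemma monic_deg_eq (A B : nzRingType) (f : A -> B) P Q : f 0 = 0 -> f 1 = 1 ->
  monic_deg P -> monic_deg Q -> (forall i, (i < d)%N -> f P`_i = Q`_i) ->
  map_poly f P = Q.
Proof.
move=> f0 f1 mP mQ eqPQ; apply/polyP => i; rewrite coef_map_id0 //.
have [/eqPQ //|le_di] := ltnP i d.
by rewrite !monic_deg_coef //; case: eqP.
Qed.

Lemma monic_deg_prod (A : idomainType) (a : 'I_d -> A) :
  monic_deg (\prod_i ('X - (a i)%:P)).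
Proof.
split; first exact: monic_prod_XsubC.
by rewrite size_prod_XsubC /index_enum -enumT size_enum_ord.
Qed.

Definition poly_cong (N : nat) (P Q : {poly int}) :=
  forall i, (N%:Z %| P`_i - Q`_i)%Z.

Lemma poly_cong_trans N P Q S : poly_cong N P Q -> poly_cong N Q S -> poly_cong N P S.
Proof. by move=> PQ QS i; rewrite -(subrKA Q`_i) rpredD. Qed.

Lemma poly_cong_dvd N M P Q : (M %| N)%N -> poly_cong N P Q -> poly_cong M P Q.
Proof. by move=> MN PQ i; apply: dvdz_trans (PQ i). Qed.

Lemma poly_cong_map (k : nzRingType) l P Q : l \in [pchar k] -> poly_cong l P Q ->
  map_poly intr P = map_poly intr Q :> {poly k}.
Proof.
move=> lk PQ; apply/polyP => i; rewrite !coef_map /=; apply/eqP.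
rewrite -subr_eq0 -rmorphB /=; have /dvdzP[c ->] := PQ i.
by rewrite intrM -pmulrn (pcharf0 lk) mulr0.
Qed.

(** The coefficients are fixed by the [l]-th power map, hence lie in the prime
    field. *)
Lemma frobenius_stable_prod (k : fieldType) (l : nat) (a : 'I_d -> k) (s : {perm 'I_d}) :
  l \in [pchar k] -> (forall i, a (s i) = a i ^+ l) ->
  exists2 P : {poly int}, monic_deg P & map_poly intr P = \prod_i ('X - (a i)%:P).
Proof.
move=> lk as_; set Q := \prod_i _; have mQ : monic_deg Q by apply: monic_deg_prod.
have fixQ : map_poly (pFrobenius_aut lk) Q = Q.
  rewrite {2}/Q (reindex_inj (@perm_inj _ s)) rmorph_prod; apply: eq_bigr => i _.
  by rewrite rmorphB /= map_polyX map_polyC /= pFrobenius_autE as_.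
have /choice[c cE] i : exists c : int, Q`_i = c%:~R.
  by apply: (frobenius_fixed_int lk); rewrite -(pFrobenius_autE lk) -coef_map fixQ.
have [P mP Pc] := monic_deg_exists c; exists P => //.
by apply: monic_deg_eq => // i lt_id; rewrite Pc // -cE.
Qed.

(** The primes are required to be arbitrarily large so that the moduli of several
    such properties can be chosen coprime. *)
Definition forced_mod_primes (Pr : {poly int} -> {poly int} -> Prop) :=
  forall B, exists2 l, prime l & (B < l)%N /\
    exists P0 Q0, [/\ monic_deg P0, monic_deg Q0
      & forall P Q, poly_cong l P P0 -> poly_cong l Q Q0 -> Pr P Q].

Lemma simultaneous_congruences (T : eqType) (s : seq T)
    (Pr : T -> {poly int} -> {poly int} -> Prop) :
  (forall t, t \in s -> forced_mod_primes (Pr t)) ->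
  exists2 N, (0 < N)%N & exists P0 Q0, [/\ monic_deg P0, monic_deg Q0
    & forall P Q, poly_cong N P P0 -> poly_cong N Q Q0 ->
      forall t, t \in s -> Pr t P Q].
Proof.
elim: s => [|t s IHs] forced.
  have [P mP _] := monic_deg_exists (fun=> 0 : int).
  by exists 1%N => //; exists P, P.
have [u us|N N0 [P0 [Q0 [mP0 mQ0 PrN]]]] := IHs.
  by apply: forced; rewrite inE us orbT.
have [l lp [ltNl [P1 [Q1 [mP1 mQ1 Prl]]]]] := forced t (mem_head _ _) N.
have cop : coprimez N l.
  rewrite coprimezE coprime_sym prime_coprime //.
  by apply/negP => /(dvdn_leq N0); rewrite leqNgt ltNl.
have crt (P P' : {poly int}) : monic_deg P -> monic_deg P' ->
    exists2 P'', monic_deg P'' & poly_cong N P'' P /\ poly_cong l P'' P'.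
  move=> mP mP'.
  have [P'' mP'' P''E] := monic_deg_exists (fun i => zchinese N l P`_i P'`_i).
  exists P'' => //; split=> i; rewrite -eqz_mod_dvd.
    have [/P''E ->|le_di] := ltnP i d; first by rewrite zchinese_modl.
    by rewrite !monic_deg_coef.
  have [/P''E ->|le_di] := ltnP i d; first by rewrite zchinese_modr.
  by rewrite !monic_deg_coef.
have [P2 mP2 [PN Pl]] := crt _ _ mP0 mP1; have [Q2 mQ2 [QN Ql]] := crt _ _ mQ0 mQ1.
exists (N * l)%N; first by rewrite muln_gt0 N0 prime_gt0.
exists P2, Q2; split=> // P Q PP2 QQ2 u; rewrite inE => /predU1P[->|us].
  apply: Prl.
    exact: poly_cong_trans (poly_cong_dvd (dvdn_mull N (dvdnn l)) PP2) Pl.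
  exact: poly_cong_trans (poly_cong_dvd (dvdn_mull N (dvdnn l)) QQ2) Ql.
apply: PrN us.
  exact: poly_cong_trans (poly_cong_dvd (dvdn_mulr l (dvdnn N)) PP2) PN.
exact: poly_cong_trans (poly_cong_dvd (dvdn_mulr l (dvdnn N)) QQ2) QN.
Qed.

(** Only the conjugacy class of [pi] is controlled, because the roots in [K] and
    those modulo a prime are not labelled compatibly. *)
Definition has_conjugate_symmetry (pi : G) (P Q : {poly int}) :=
  forall (K : numFieldType) (a b : 'I_d -> K),
    map_poly intr P = \prod_i ('X - (a i)%:P) ->
    map_poly intr Q = \prod_j ('X - (b j)%:P) ->
    exists t : G, rational_symmetry a b (pi ^ t)%g.

(** Modulo a large prime [l], choose the roots in a field with [l ^ d`!] elements so
    that the [l]-th power map permutes them by [pi]. *)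
Lemma forced_symmetry pi : forced_mod_primes (has_conjugate_symmetry pi).
Proof.
move=> B.
have [l lbig lp] := prime_above (B + d * d * d + #|{: G * G}| * (d + d)).
exists l => //; split; first by apply: leq_ltn_trans lbig; lia.
have n0 : (0 < d`!)%N by apply: fact_gt0.
have [k lk cardk] := PrimePowerField lp n0.
have expd (s : {perm 'I_d}) : (s ^+ d`! = 1)%g.
  by rewrite -card_Sn -cardsT expg_cardG ?inE.
have bigd : (d * d * d < l)%N by apply: leq_ltn_trans lbig; lia.
have [a inja aE] := frobenius_orbit_points lk cardk n0 (expd pi.1) bigd.
have [b injb bE] := frobenius_orbit_points lk cardk n0 (expd pi.2) bigd.
have [|th inj_th] := separating_form lk inja injb.
  by apply: leq_ltn_trans lbig; lia.
have [P0 mP0 P0E] := frobenius_stable_prod lk aE.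
have [Q0 mQ0 Q0E] := frobenius_stable_prod lk bE.
exists P0, Q0; split=> // P Q PP0 QQ0 K x y Px Qy.
apply: (frobenius_symmetry lk Px Qy _ _ aE bE inj_th).
  by rewrite (poly_cong_map lk PP0).
by rewrite (poly_cong_map lk QQ0).
Qed.

End SpecialPairs.

(** * Pairs of integral polynomials with full symmetry *)

Section Kronecker.

Lemma digits_inj (D n : nat) (f g : nat -> nat) :
  (forall i, f i < D)%N -> (forall i, g i < D)%N ->
  (\sum_(i < n) f i * D ^ i = \sum_(i < n) g i * D ^ i)%N ->
  forall i, (i < n)%N -> f i = g i.
Proof.
elim: n f g => [|n IHn] f g fD gD // efg.
have step (h : nat -> nat) : (\sum_(i < n.+1) h i * D ^ i =
    (\sum_(i < n) h i.+1 * D ^ i) * D + h 0)%N.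
  rewrite big_ord_recl /= expn0 muln1 addnC big_distrl /=; congr (_ + _)%N.
  by apply: eq_bigr => i _; rewrite /bump /= expnSr mulnA.
rewrite !step in efg; have D0 : (0 < D)%N by apply: leq_ltn_trans (fD 0%N).
have f0 : f 0%N = g 0%N.
  by have := congr1 (modn^~ D) efg; rewrite /= !modnMDl !modn_small.
move: efg; rewrite f0 => /addIn /eqP; rewrite eqn_pmul2r // => /eqP.
move/(IHn (f \o succn) (g \o succn) (fun i => fD i.+1) (fun i => gD i.+1)) => efg.
by case=> // i lt_in; apply: efg.
Qed.

(** Kronecker substitution: replacing the [i]-th variable by the power [D ^ i] of one
    variable keeps distinct monomials distinct as long as all exponents are less
    than [D]. *)
Lemma mpoly_int_nonroot (n : nat) (P : mpoly n int) : P != 0 ->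
  exists x : 'I_n -> int, meval x P != 0.
Proof.
move=> P0; pose D := msize P.
pose w (m : multinom n) := (\sum_(i < n) m i * D ^ i)%N.
have ltD m : m \in msupp P -> forall i, (m i < D)%N.
  move=> mP i; apply: leq_ltn_trans (msize_mdeg_lt mP).
  by rewrite mdegE (bigD1 i) //= leq_addr.
pose Q : {poly int} := \sum_(m <- msupp P) mcoeff m P *: 'X^(w m).
have [m mP] : exists m, m \in msupp P.
  case E: (msupp P) => [|m s]; last by exists m; rewrite mem_head.
  by move/eqP: E; rewrite msupp_eq0 (negPf P0).
have Qm : Q`_(w m) = mcoeff m P.
  rewrite coef_sum (bigD1_seq m) ?msupp_uniq //= coefZ coefXn eqxx mulr1.
  rewrite big_seq_cond big1 ?addr0 // => m' /andP[m'P m'm].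
  rewrite coefZ coefXn; case: eqP => [ew|]; last by rewrite mulr0.
  case/eqP: m'm; apply/mnmP => i.
  pose e (u : multinom n) j := oapp u 0%N (insub j : option 'I_n).
  have eE u : u \in msupp P -> forall j, (e u j < D)%N.
    move=> uP j; rewrite /e; case: insub => [j'|] /=; first exact: ltD.
    exact: leq_ltn_trans (ltD _ mP i).
  have wE u : w u = (\sum_(j < n) e u j * D ^ j)%N.
    by apply: eq_bigr => j _; rewrite /e valK.
  have := @digits_inj D n (e m') (e m) (eE _ m'P) (eE _ mP).
  by rewrite -!wE => /(_ (esym ew) i (ltn_ord i)); rewrite /e valK.
have Q0 : Q != 0.
  by apply/eqP => Q0; move: mP; rewrite mcoeff_msupp -Qm Q0 coef0 eqxx.
have [||||t _ Qt] := @avoid_roots int unit predT (fun=> Q) (size Q)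
  [seq c%:Z | c <- iota 0 (size Q).+1].
- by rewrite map_inj_uniq ?iota_uniq // => x y [].
- by rewrite card_unit mul1n size_map size_iota.
- by [].
- by move=> _ _.
exists (fun i => t ^+ (D ^ i)); have := Qt tt isT; apply: contraNN => /eqP <-.
rewrite mevalE /Q horner_sum; apply/eqP/eq_bigr => u _.
rewrite hornerZ hornerXn; congr (_ * _); rewrite /w expr_sum.
by apply: eq_bigr => i _; rewrite -exprM mulnC.
Qed.

End Kronecker.

Section Separation.

Variable d : nat.
Local Notation G := ({perm 'I_d} * {perm 'I_d})%type.
Variable F : mpoly (d + d) int.

Definition separates_orbit (K : nzRingType) (a b : 'I_d -> K) :=
  forall g h : G, act g F != act h F ->
    mmap intr (pt a b) (act g F) != mmap intr (pt a b) (act h F).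

(** A discriminant of the orbit of [F]: an invariant integral polynomial whose
    nonvanishing separates the values on the orbit. *)
Definition orbit_discr : mpoly (d + d) int :=
  \prod_(gh : G * G | act gh.1 F != act gh.2 F) (act gh.1 F - act gh.2 F).

Lemma orbit_discr_invariant : act_invariant orbit_discr.
Proof.
move=> u; rewrite rmorph_prod /=.
pose v (gh : G * G) : G * G := ((gh.1 * u)%g, (gh.2 * u)%g).
have injv : injective v.
  move=> [g h] [g' h'] e; congr (_, _); first exact: mulIg (congr1 fst e).
  exact: mulIg (congr1 snd e).
have v1 gh : act (v gh).1 F = act u (act gh.1 F) by apply: actM.
have v2 gh : act (v gh).2 F = act u (act gh.2 F) by apply: actM.
have neqE (S T S' T' : mpoly (d + d) int) :
    S' = act u S -> T' = act u T -> (S != T) = (S' != T').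
  by move=> -> ->; rewrite act_eq.
have subE (S T S' T' : mpoly (d + d) int) :
    S' = act u S -> T' = act u T -> act u (S - T) = S' - T'.
  by move=> -> ->; rewrite rmorphB.
rewrite [RHS](reindex_inj injv); apply: eq_big => [gh|gh _].
  exact: neqE (v1 gh) (v2 gh).
exact: subE (v1 gh) (v2 gh).
Qed.

Lemma separates_orbitP (K : idomainType) (a b : 'I_d -> K) :
  mmap intr (pt a b) orbit_discr != 0 -> separates_orbit a b.
Proof.
rewrite rmorph_prod => /prodf_neq0 D0 g h gh; have /= := D0 (g, h) gh.
by rewrite rmorphB subr_eq0.
Qed.

(** Take [P0] and [Q0] with integral roots at which the discriminant of the orbit
    does not vanish, and a prime [l] that does not divide its value there. For [P]
    and [Q] congruent to them modulo [l], its value at the roots of [P] and [Q] is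
    an integer congruent to that one, hence not zero. *)
Lemma forced_separation : forced_mod_primes d (fun P Q =>
  forall (K : numFieldType) (a b : 'I_d -> K),
    map_poly intr P = \prod_i ('X - (a i)%:P) ->
    map_poly intr Q = \prod_j ('X - (b j)%:P) -> separates_orbit a b).
Proof.
have D0 : orbit_discr != 0.
  by apply/prodf_neq0 => gh; rewrite subr_eq0.
have [x Dx] := mpoly_int_nonroot D0.
pose a0 i := x (lshift d i); pose b0 j := x (rshift d j).
have x_pt : x =1 pt a0 b0.
  move=> k; rewrite -(splitK k); case: (fintype.split k) => i /=.
    by rewrite pt_lshift.
  by rewrite pt_rshift.
move=> B; have [l lbig lp] := prime_above (B + `|meval x orbit_discr|).
exists l => //; split; first by apply: leq_ltn_trans lbig; rewrite leq_addr.
exists (\prod_i ('X - (a0 i)%:P)), (\prod_j ('X - (b0 j)%:P)).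
split; [exact: monic_deg_prod.. | move=> P Q PP0 QQ0 K a b Pa Qb].
apply: separates_orbitP.
have [c cE] := invariant_transfer P Q orbit_discr_invariant.
rewrite (cE _ _ _ _ Pa Qb) intr_eq0; apply: contraTneq lbig => c0.
have lk : l \in [pchar 'F_l] by apply: pchar_Fp.
have := cE 'F_l intr (intr \o a0) (intr \o b0).
rewrite c0 rmorph0 (poly_cong_map lk PP0) (poly_cong_map lk QQ0).
have intrE (y : 'I_d -> int) : map_poly intr (\prod_i ('X - (y i)%:P)) =
    \prod_i ('X - ((y i)%:~R)%:P) :> {poly 'F_l}.
  rewrite rmorph_prod; apply: eq_bigr => i _ /=.
  by rewrite rmorphB /= map_polyX map_polyC.
move=> /(_ (intrE _) (intrE _)).
have -> : mmap intr (pt (intr \o a0) (intr \o b0)) orbit_discr =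
    (meval x orbit_discr)%:~R :> 'F_l.
  rewrite /meval (rmorph_mmap idfun intr); apply: eq_mmap => // k.
  by rewrite /= x_pt /pt; case: (fintype.split k).
move=> D0l; rewrite -leqNgt -{1}[l](addn0 l).
have : (l %| `|meval x orbit_discr|)%N.
  rewrite (dvdn_pcharf lk); move/eqP: D0l.
  by case: (intP (meval x orbit_discr)) => [|n|n]; rewrite ?rmorphN ?oppr_eq0 ?abszN.
by move/dvdn_leq; rewrite absz_gt0 Dx => /(_ isT); lia.
Qed.

End Separation.

Section FullSymmetry.

Variable d : nat.
Local Notation G := ({perm 'I_d} * {perm 'I_d})%type.

Lemma rational_symmetry_all (K : numFieldType) (a b : 'I_d -> K) :
  (forall pi : G, exists t : G, rational_symmetry a b (pi ^ t)%g) ->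
  forall g : G, rational_symmetry a b g.
Proof.
move=> meet; pose H := [set g : G | `[< rational_symmetry a b g >]]%SET.
have HP g : (g \in H) <-> rational_symmetry a b g.
  by rewrite inE; split=> [/asboolW|/asboolT].
have gH : group_set H.
  apply/group_setP; split=> [|g h /HP sg /HP sh]; apply/HP => S S0.
    by rewrite -S0; apply: eq_mmap_pt => i; rewrite /= perm1.
  have := sh _ (etrans (mmap_act _ _ _ _ _) (sg _ S0)).
  by rewrite mmap_act => <-; apply: eq_mmap_pt => i /=; rewrite permM.
have HT : H = [set: _]%SET.
  apply: (@conjugates_cover _ (Group gH)) => x; have [t xt] := meet x.
  by exists t; apply/HP.
by move=> g; apply/HP; rewrite HT inE.
Qed.

(** One congruence modulo [N] is imposed for each element of the group and one for
    the separation of the orbit of [F]. The group of rational symmetries then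
    meets every conjugacy class, so it is everything by [conjugates_cover]. *)
Lemma special_pairs (F : mpoly (d + d) int) :
  exists2 N, (0 < N)%N & exists P0 Q0, [/\ monic_deg d P0, monic_deg d Q0
  & forall P Q, poly_cong N P P0 -> poly_cong N Q Q0 ->
    forall (K : numFieldType) (a b : 'I_d -> K),
      map_poly intr P = \prod_i ('X - (a i)%:P) ->
      map_poly intr Q = \prod_j ('X - (b j)%:P) ->
      (forall g : G, rational_symmetry a b g) /\ separates_orbit F a b].
Proof.
pose Pr (o : option G) P Q :=
  if o is Some pi then has_conjugate_symmetry pi P Q else
  forall (K : numFieldType) (a b : 'I_d -> K),
    map_poly intr P = \prod_i ('X - (a i)%:P) ->
    map_poly intr Q = \prod_j ('X - (b j)%:P) -> separates_orbit F a b.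
have [|N N0 [P0 [Q0 [mP0 mQ0 PrN]]]] :=
    @simultaneous_congruences d _ (enum {: option G}) Pr.
  by case=> [pi|] _; [apply: forced_symmetry | apply: forced_separation].
exists N => //; exists P0, Q0; split=> // P Q PP0 QQ0 K a b Pa Qb.
split; last by apply: (PrN P Q PP0 QQ0 None) => //; rewrite mem_enum.
apply: rational_symmetry_all => pi.
by apply: (PrN P Q PP0 QQ0 (Some pi)) => //; rewrite mem_enum.
Qed.

End FullSymmetry.

(** * The quadratic form of the cost and its stabiliser *)

Section Stabilizer.

Variable d : nat.
Local Notation G := ({perm 'I_d} * {perm 'I_d})%type.
Variables (phi psi : {perm 'I_d}) (m : 'I_d -> 'I_d -> nat).
Hypotheses (phiK : involutive phi) (psiK : involutive psi).
Hypotheses (m_row : forall i, (\sum_j m i j)%N = 2%N).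
Hypotheses (m_col : forall j, (\sum_i m i j)%N = 2%N).
Hypothesis m_inv : forall i j, m (phi i) (psi j) = m i j.

(** With [m] the edge multiplicities of the graph, this is [2 * d] times the polynomial
    [f_poly]; it has integral coefficients. *)
Definition cost_form : mpoly (d + d) int :=
  \sum_i \sum_j ((mpolyX _ (mnm1 (lshift d i)) - mpolyX _ (mnm1 (rshift d j))) *
    (mpolyX _ (mnm1 (lshift d (phi i))) - mpolyX _ (mnm1 (rshift d (psi j))))) *+ m i j.

Lemma mmap_cost_form (B : comNzRingType) (u v : 'I_d -> B) :
  mmap intr (pt u v) cost_form =
  \sum_i \sum_j ((u i - v j) * (u (phi i) - v (psi j))) *+ m i j.
Proof.
rewrite rmorph_sum; apply: eq_bigr => i _ /=.
rewrite rmorph_sum; apply: eq_bigr => j _ /=.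
by rewrite rmorphMn rmorphM !rmorphB /= !mmapXU !pt_lshift !pt_rshift.
Qed.

Lemma mmap_cost_form_scale (B : comNzRingType) (c : B) (u v : 'I_d -> B) :
  mmap intr (pt (fun i => c * u i) (fun j => c * v j)) cost_form =
  c ^+ 2 * mmap intr (pt u v) cost_form.
Proof.
rewrite !mmap_cost_form mulr_sumr; apply: eq_bigr => i _.
rewrite mulr_sumr; apply: eq_bigr => j _.
by rewrite [RHS]mulrnAr; congr (_ *+ _); ring.
Qed.

(** The two mixed sums agree because [m] is invariant under [(phi, psi)]. In this
    form the graph can be read off the coefficients. *)
Lemma mmap_cost_form_expand (B : comNzRingType) (u v : 'I_d -> B) :
  mmap intr (pt u v) cost_form =
  (\sum_i u i * u (phi i)) *+ 2 + (\sum_j v j * v (psi j)) *+ 2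
  - (\sum_i \sum_j (u i * v j) *+ m (phi i) j) *+ 2.
Proof.
rewrite mmap_cost_form.
transitivity (\sum_i \sum_j ((u i * u (phi i)) *+ m i j + (v j * v (psi j)) *+ m i j
    - ((u i * v (psi j)) *+ m i j + (u (phi i) * v j) *+ m i j))).
  apply: eq_bigr => i _; apply: eq_bigr => j _.
  by rewrite -!mulrnDl -mulrnBl; congr (_ *+ _); ring.
under eq_bigr do rewrite sumrB !big_split /=.
rewrite sumrB !big_split /=; congr (_ + _ - _).
- rewrite -sumrMnl; apply: eq_bigr => i _.
  by rewrite sumrMnr m_row.
- rewrite exchange_big -sumrMnl; apply: eq_bigr => j _ /=.
  by rewrite sumrMnr m_col.
rewrite mulr2n; congr (_ + _).
  apply: eq_bigr => i _; rewrite (reindex_inj (@perm_inj _ psi)) /=.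
  apply: eq_bigr => j _; rewrite psiK; congr (_ *+ _).
  by rewrite -m_inv psiK.
rewrite (reindex_inj (@perm_inj _ phi)) /=; apply: eq_bigr => i _.
by rewrite phiK.
Qed.

Definition graph_aut (g : G) :=
  [/\ forall i, g.1 (phi i) = phi (g.1 i), forall j, g.2 (psi j) = psi (g.2 j)
    & forall i j, m (g.1 i) (g.2 j) = m i j].

(** The coefficients of the form determine [phi], [psi] and [m]; they are extracted
    by the polar form at pairs of basis vectors. *)
Lemma graph_autP g : act g cost_form = cost_form <-> graph_aut g.
Proof.
split=> [stab | [cphi cpsi cm]]; last first.
  rewrite /cost_form rmorph_sum [RHS](reindex_inj (@perm_inj _ g.1)).
  apply: eq_bigr => i _; rewrite rmorph_sum [RHS](reindex_inj (@perm_inj _ g.2)).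
  apply: eq_bigr => j _; rewrite rmorphMn rmorphM !rmorphB /= !actXl !actXr.
  by rewrite cphi cpsi cm.
pose ev (u v : 'I_d -> int) := mmap intr (pt u v) cost_form.
have evg u v : ev (u \o g.1) (v \o g.2) = ev u v by rewrite /ev -mmap_act stab.
pose e (i : 'I_d) (k : 'I_d) : int := (k == i)%:R.
have sum_e (F : 'I_d -> int) i : \sum_k e i k * F k = F i.
  rewrite (bigD1 i) //= /e eqxx mul1r big1 ?addr0 // => k /negPf ->.
  by rewrite mul0r.
(* Polarisation isolates single coefficients of the quadratic form [ev]. *)
pose polar (u v u' v' : 'I_d -> int) :=
  ev (fun k => u k + u' k) (fun k => v k + v' k) - ev u v - ev u' v'.
have polarE u v u' v' : polar u v u' v' =
    (\sum_i u i * u' (phi i)) *+ 4 + (\sum_j v j * v' (psi j)) *+ 4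
    - (\sum_i \sum_j (u i * v' j + u' i * v j) *+ m (phi i) j) *+ 2.
  have swap (s : {perm 'I_d}) (w w' : 'I_d -> int) : involutive s ->
      \sum_i (w i + w' i) * (w (s i) + w' (s i)) =
      \sum_i w i * w (s i) + \sum_i w' i * w' (s i) + (\sum_i w i * w' (s i)) *+ 2.
    move=> sK; have -> : (\sum_i w i * w' (s i)) *+ 2 =
        \sum_i w i * w' (s i) + \sum_i w' i * w (s i).
      rewrite mulr2n; congr (_ + _); rewrite (reindex_inj (@perm_inj _ s)) /=.
      by apply: eq_bigr => i _; rewrite sK mulrC.
    by rewrite -!big_split; apply: eq_bigr => i _ /=; ring.
  rewrite /polar /ev !mmap_cost_form_expand !swap //.
  have -> : \sum_i \sum_j ((u i + u' i) * (v j + v' j)) *+ m (phi i) j =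
      \sum_i \sum_j (u i * v j) *+ m (phi i) j +
      \sum_i \sum_j (u' i * v' j) *+ m (phi i) j +
      \sum_i \sum_j (u i * v' j + u' i * v j) *+ m (phi i) j.
    rewrite -!big_split; apply: eq_bigr => i _; rewrite -!big_split.
    by apply: eq_bigr => j _ /=; rewrite -!mulrnDl; congr (_ *+ _); ring.
  ring.
have polarg u v u' v' : polar (u \o g.1) (v \o g.2) (u' \o g.1) (v' \o g.2) =
    polar u v u' v'.
  by rewrite /polar -(evg u) -(evg u') -(evg (fun k => u k + u' k)).
have eg (s : {perm 'I_d}) i : e (s i) \o s = e i.
  by apply/funext => k; rewrite /e /= (inj_eq perm_inj).
pose z (k : 'I_d) : int := 0.
have nat_eq (b c : bool) (n : nat) : (0 < n)%N -> b%:R *+ n = c%:R *+ n :> int -> b -> c.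
  move=> n0; case: b c => [] [] //.
  by rewrite mul0rn => /eqP; rewrite pnatr_eq0 => /eqP n00; rewrite n00 in n0.
have polar_xx i k : polar (e i) z (e k) z = (phi i == k)%:R *+ 4.
  rewrite polarE sum_e big1 => [|j _]; last by rewrite mul0r.
  rewrite big1 ?addr0 ?subr0 // => j _.
  by rewrite big1 // => j' _; rewrite !mulr0 addr0 mul0rn.
have polar_yy j k : polar z (e j) z (e k) = (psi j == k)%:R *+ 4.
  rewrite polarE sum_e big1 => [|i _]; last by rewrite mul0r.
  rewrite [X in _ - X]mulr2n big1 ?add0r ?subr0 // => i _.
  by rewrite big1 // => j' _; rewrite !mul0r addr0 mul0rn.
have polar_xy i j : polar (e i) z z (e j) = - ((m (phi i) j)%:R *+ 2).
  rewrite polarE big1 => [|k _]; last by rewrite mulr0.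
  rewrite big1 => [|k _]; last by rewrite mul0r.
  rewrite mul0rn !add0r; congr (- (_ *+ _)).
  transitivity (\sum_k e i k * (\sum_l e j l * (m (phi k) l)%:R)); last by rewrite !sum_e.
  apply: eq_bigr => k _; rewrite mulr_sumr; apply: eq_bigr => l _.
  by rewrite mul0r addr0 -mulr_natr mulrA.
have cphi i : g.1 (phi i) = phi (g.1 i).
  apply/esym/eqP; move: (polarg (e (g.1 i)) z (e (g.1 (phi i))) z).
  by rewrite !eg !polar_xx => /nat_eq -> //.
have cpsi j : g.2 (psi j) = psi (g.2 j).
  apply/esym/eqP; move: (polarg z (e (g.2 j)) z (e (g.2 (psi j)))).
  by rewrite !eg !polar_yy => /nat_eq -> //.
split=> // i j; have := polarg (e (g.1 (phi i))) z z (e (g.2 j)).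
rewrite !eg !polar_xy phiK -cphi phiK => /oppr_inj.
by rewrite -!mulrnA => /eqP; rewrite eqr_nat eqn_pmul2r // => /eqP.
Qed.

End Stabilizer.

(** * The graph of a vertex *)

Section GraphOfVertex.

Variables (R : realType) (d : nat) (phi psi : {perm 'I_d}) (M : 'M[R]_d).
Local Notation G := ({perm 'I_d} * {perm 'I_d})%type.
Hypotheses (phiK : involutive phi) (psiK : involutive psi).
Hypothesis M_birk : inv_birkhoff phi psi M.
Hypothesis M_half : forall i j, M i j \in [:: 0; 2^-1; 1].
Local Notation F := (cost_form phi psi (mult M)).

Lemma multE i j : (mult M i j)%:R = 2 * M i j.
Proof.
rewrite -[in RHS](map_ratmx M_half) !mxE rmorphM fmorphV !rmorph_nat mulrC.
by rewrite divfK // pnatr_eq0.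
Qed.

Lemma mult_row i : (\sum_j mult M i j)%N = 2%N.
Proof.
apply/eqP; rewrite -(eqr_nat R) natr_sum; under eq_bigr do rewrite multE.
by case: M_birk => [[_ rowM _] _]; rewrite -mulr_sumr rowM mulr1.
Qed.

Lemma mult_col j : (\sum_i mult M i j)%N = 2%N.
Proof.
apply/eqP; rewrite -(eqr_nat R) natr_sum; under eq_bigr do rewrite multE.
by case: M_birk => [[_ _ colM] _]; rewrite -mulr_sumr colM mulr1.
Qed.

Lemma mult_inv i j : mult M (phi i) (psi j) = mult M i j.
Proof. by case: M_birk => [_ invM]; rewrite /mult -invM. Qed.

Lemma Aut_iotaP g : reflect (graph_aut phi psi (mult M) g) (g \in Aut_iota phi psi M).
Proof.
rewrite inE; apply: (iffP andP) => [[/forallP edg /forallP com]|[cphi cpsi cm]].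
  split=> [i|j|i j].
  - by have /eqP[] := com (inl i).
  - by have /eqP[] := com (inr j).
  - by have /forallP/(_ (inr j))/eqP := edg (inl i).
split; apply/forallP => -[i|j] /=; rewrite ?cphi ?cpsi //;
  apply/forallP => -[i'|j'] //=; by rewrite cm.
Qed.

Lemma stabilizerP g : reflect (act g F = F) (g \in Aut_iota phi psi M).
Proof.
apply: (iffP (Aut_iotaP g)); rewrite graph_autP //;
  [exact: mult_row|exact: mult_col|exact: mult_inv|
   exact: mult_row|exact: mult_col|exact: mult_inv].
Qed.

Lemma Aut_iota_group : group_set (Aut_iota phi psi M).
Proof.
apply/group_setP; split=> [|g h /stabilizerP sg /stabilizerP sh].
  by apply/stabilizerP; rewrite act1.
by apply/stabilizerP; rewrite actM sg.
Qed.

Definition Aut_iota_Group := Group Aut_iota_group.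

Lemma f_polyE : f_poly phi psi M = (d%:R^-1 / 2) *: map_mpoly intr F.
Proof.
rewrite /f_poly -scalerA; congr (_ *: _).
rewrite /cost_form rmorph_sum scaler_sumr; apply: eq_bigr => i _ /=.
rewrite rmorph_sum scaler_sumr; apply: eq_bigr => j _ /=.
rewrite rmorphMn rmorphM !rmorphB /= !map_mpolyX -scaler_nat scalerA mxE.
by rewrite mulrC.
Qed.

Lemma act_repr_inj (C D : {set G}) :
  C \in rcosets (Aut_iota phi psi M) [set: G] ->
  D \in rcosets (Aut_iota phi psi M) [set: G] ->
  @act d _ (repr C) F = @act d _ (repr D) F -> C = D.
Proof.
have rcoset_repr_id (E : {set G}) : E \in rcosets (Aut_iota phi psi M) [set: G] ->
    E = (Aut_iota_Group :* repr E)%g.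
  case/rcosetsP => x _ ->; apply/esym/rcoset_eqP.
  exact: (mem_repr_rcoset Aut_iota_Group x).
move=> /rcoset_repr_id {2}-> /rcoset_repr_id {2}-> eCD; apply/rcoset_eqP.
rewrite mem_rcoset; apply/stabilizerP.
by rewrite actM eCD -actM mulgV act1.
Qed.

End GraphOfVertex.

(** * Hall's marriage theorem *)

Section Hall.

Variable T : finType.

Definition neighbours (r : rel T) (S : {set T}) : {set T} :=
  [set y | [exists x in S, r x y]]%SET.

Lemma mem_neighbours (r : rel T) (S : {set T}) x y :
  x \in S -> r x y -> y \in neighbours r S.
Proof. by move=> xS rxy; rewrite inE; apply/existsP; exists x; rewrite xS. Qed.

(** Halmos and Vaughan's induction: either some proper nonempty subset is tight, and
    it can be matched separately from its complement, or one pair can be matched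
    arbitrarily without violating the condition. *)
Lemma hall_matching (r : rel T) (A : {set T}) :
  (forall S : {set T}, S \subset A -> #|S| <= #|neighbours r S|)%N ->
  exists2 f : T -> T, {in A &, injective f} & {in A, forall x, r x (f x)}.
Proof.
have [n] := ubnP #|A|; elim: n => // n IHn in r A * => /ltnSE leAn hallA.
have [->|[x0 x0A]] := set_0Vmem A.
  by exists id => [x y|x]; rewrite inE.
have [/existsP[S /and4P[SA SnA S0 /eqP tight]]|] := boolP [exists S : {set T},
    [&& S \subset A, S != A, S != finset.set0 & #|neighbours r S| == #|S|]]%SET.
  have ltSA : (#|S| < #|A|)%N by rewrite proper_card // finset.properEneq SnA.
  have [|S' S'S|f1 inj1 r1] := IHn r S; first exact: leq_trans leAn.
    exact/hallA/(fintype.subset_trans S'S).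
  pose r' x y := r x y && (y \notin neighbours r S).
  have [||f2 inj2 r2] := IHn r' (A :\: S)%SET.
  - apply: leq_trans leAn; rewrite proper_card // finset.properEneq finset.subsetDl andbT.
    apply/negP => /eqP; move=> e; case/finset.set0Pn: S0 => x xS.
    by have := fintype.subsetP SA x xS; rewrite -e !inE xS.
  - move=> S' S'A.
    have dis : [disjoint S' & S].
      by rewrite finset.disjoints_subset (fintype.subset_trans S'A) // finset.subDset finset.setUCr finset.subsetT.
    have : (#|S' :|: S|%SET <= #|neighbours r (S' :|: S)%SET|)%N.
      apply: hallA; rewrite finset.subUset SA andbT.
      by rewrite (fintype.subset_trans S'A) // finset.subsetDl.
    rewrite cardsU (disjoint_setI0 dis) cards0 subn0.
    have : neighbours r (S' :|: S)%SET \subset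
        (neighbours r' S' :|: neighbours r S)%SET.
      apply/fintype.subsetP => y; rewrite !inE.
      case/existsP=> x /andP[]; rewrite inE => xS rxy.
      have [yS|yS] := boolP (y \in neighbours r S).
        by apply/orP; right; move: yS; rewrite inE.
      apply/orP; left; apply/existsP; exists x; rewrite /r' rxy yS !andbT.
      case/orP: xS => // xS; case/negP: yS; exact: mem_neighbours rxy.
    move=> /subset_leq_card le1 le2; have := leq_trans le2 (leq_trans le1 (leq_card_setU _ _)).
    by rewrite tight leq_add2r.
  exists (fun x => if x \in S then f1 x else f2 x) => [x y xA yA|x xA].
    have f12 u v : u \in S -> v \in A -> v \notin S -> f1 u != f2 v.
      move=> uS vA vS.
      have /r2/andP[_] : v \in (A :\: S)%SET by rewrite inE vS vA.
      by apply: contraNneq => <-; apply: mem_neighbours (r1 u uS).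
    case: ifPn => xS; case: ifPn => yS.
    - exact: inj1.
    - by move=> e; have := f12 x y xS yA yS; rewrite e eqxx.
    - by move=> e; have := f12 y x yS xA xS; rewrite e eqxx.
    - by apply: inj2; rewrite inE ?xS ?yS.
  case: ifPn => xS; first exact: r1.
  by have /r2/andP[] : x \in (A :\: S)%SET by rewrite inE xS.
rewrite negb_exists => /forallP loose.
have /card_gt0P[y0] : (0 < #|neighbours r [set x0]|)%N.
  by apply: leq_trans (hallA _ _); rewrite ?cards1 ?finset.sub1set.
rewrite inE => /existsP[x /andP[]]; rewrite inE => /eqP -> r0.
pose r' x y := r x y && (y != y0).
have [||f injf rf] := IHn r' (A :\ x0)%SET.
- by move: leAn; rewrite (cardsD1 x0 A) x0A add1n.
- move=> S SA; have [->|S0] := eqVneq S finset.set0; first by rewrite cards0.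
  have SA' : S \subset A by rewrite (fintype.subset_trans SA) // finset.subsetDl.
  have ltS : (#|S| < #|neighbours r S|)%N.
    have SneA : S != A.
      apply: contraTneq SA => ->; apply/negP => /fintype.subsetP /(_ _ x0A).
      by rewrite !inE eqxx.
    have := loose S; rewrite SA' S0 SneA /= => neqNS.
    by rewrite ltn_neqAle eq_sym neqNS hallA.
  rewrite -ltnS (leq_trans ltS) //.
  have : neighbours r S \subset (y0 |: neighbours r' S)%SET.
    apply/fintype.subsetP => y; rewrite !inE => /existsP[u /andP[uS ruy]].
    have [//|yy0 /=] := eqVneq y y0; apply/existsP; exists u.
    by rewrite uS /r' ruy yy0.
  move/subset_leq_card/leq_trans; apply; rewrite cardsU1.
  by case: (y0 \notin _); rewrite ?add1n ?add0n // leqW.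
exists (fun x => if x == x0 then y0 else f x) => [u v uA vA|u uA].
  have fy0 w : w \in A -> w != x0 -> f w != y0.
    by move=> wA wx0; have /rf/andP[] : w \in (A :\ x0)%SET by rewrite !inE wx0.
  have [->|ux] := eqVneq u x0; have [->|vx] := eqVneq v x0 => //.
  - by move=> e; have := fy0 v vA vx; rewrite -e eqxx.
  - by move=> e; have := fy0 u uA ux; rewrite e eqxx.
  - by apply: injf; rewrite !inE ?ux ?vx.
case: eqVneq => [->|ux] //.
by have /rf/andP[] : u \in (A :\ x0)%SET by rewrite !inE ux.
Qed.

End Hall.

(** * The Birkhoff polytope *)

Section BirkhoffVonNeumann.

Variables (R : realType) (d : nat).
Hypothesis d_gt0 : (0 < d)%N.
Implicit Types (N : 'M[R]_d) (s : {perm 'I_d}).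

Definition line_sums N (c : R) :=
  [/\ forall i j, 0 <= N i j, forall i, \sum_j N i j = c & forall j, \sum_i N i j = c].

Lemma perm_mxE s i j : perm_mx s i j = (s i == j)%:R :> R.
Proof. by rewrite !mxE. Qed.

Lemma line_sums_perm s : line_sums (perm_mx s) 1.
Proof.
split=> [i j|i|j]; first by rewrite perm_mxE ler0n.
  under eq_bigr do rewrite perm_mxE.
  rewrite (bigD1 (s i)) //= eqxx big1 ?addr0 // => j /negPf.
  by rewrite eq_sym => ->.
under eq_bigr do rewrite perm_mxE.
rewrite (bigD1 ((s^-1)%g j)) //= permKV eqxx big1 ?addr0 // => i /negPf ij.
by rewrite (canF_eq (permK s)) ij.
Qed.

Lemma line_sums_comb (c1 c2 t1 t2 : R) N1 N2 : 0 <= t1 -> 0 <= t2 ->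
  line_sums N1 c1 -> line_sums N2 c2 ->
  line_sums (t1 *: N1 + t2 *: N2) (t1 * c1 + t2 * c2).
Proof.
move=> t10 t20 [p1 r1 k1] [p2 r2 k2]; split=> [i j|i|j].
- by rewrite !mxE addr_ge0 // mulr_ge0.
- by under eq_bigr do rewrite !mxE; rewrite big_split -!mulr_sumr r1 r2.
- by under eq_bigr do rewrite !mxE; rewrite big_split -!mulr_sumr k1 k2.
Qed.

(** Hall's condition holds because a set of rows carries a total mass proportional
    to its size, and its neighbours carry at least this mass. *)
Lemma positive_diagonal N c : 0 < c -> line_sums N c ->
  exists s : {perm 'I_d}, forall i, 0 < N i (s i).
Proof.
move=> c0 [N0 rowN colN]; pose r i j := 0 < N i j.
have [|f injf rf] := @hall_matching _ r [set: 'I_d]%SET.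
  move=> S _; rewrite -(ler_nat R) -(ler_pM2r c0) !mulr_natl.
  rewrite -!sumr_const.
  apply: (@le_trans _ _ (\sum_(i in S) \sum_(j in neighbours r S) N i j)).
    apply: ler_sum => i iS; rewrite -(rowN i) (bigID (mem (neighbours r S))) /=.
    rewrite gerDl big1 // => j; apply: contraNeq => Nij.
    by apply: mem_neighbours iS _; rewrite /r lt_def Nij N0.
  rewrite exchange_big /=; apply: ler_sum => j _.
  rewrite -(colN j) [leRHS](bigID (mem S)) /= lerDl.
  by apply: sumr_ge0.
have injf' : injective f by move=> x y; apply: injf; rewrite inE.
by exists (perm injf') => i; rewrite permE; apply: rf; rewrite inE.
Qed.

(** Subtract the largest possible multiple of a permutation matrix supported in [N]
    and argue by induction on the number of nonzero entries. *)
Lemma birkhoff_von_neumann N c : line_sums N c ->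
  exists2 w : {perm 'I_d} -> R, forall s, 0 <= w s &
    N = \sum_s w s *: perm_mx s /\ \sum_s w s = c.
Proof.
have [n] := ubnP #|[set ij | N ij.1 ij.2 != 0]%SET|.
elim: n => // n IHn in N c * => /ltnSE leNn lsN.
have [N0 rowN colN] := lsN; pose i0 := Ordinal d_gt0.
have c_ge0 : 0 <= c by rewrite -(rowN i0) sumr_ge0.
have [c0|c_neq0] := eqVneq c 0.
  exists (fun=> 0) => //; split; last by rewrite c0 big1.
  rewrite big1 => [|s _]; last by rewrite scale0r.
  apply/matrixP => i j; rewrite mxE; apply/eqP; rewrite eq_le N0 andbT.
  by rewrite -c0 -(rowN i) (bigD1 j) //= lerDl sumr_ge0.
have [|s sN] := @positive_diagonal N c _ lsN; first by rewrite lt_def c_neq0.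
have [i1 _ i1min] := @arg_minP _ _ _ i0 predT (fun i => N i (s i)) isT.
set m := N i1 (s i1) in i1min; pose N' := N - m *: perm_mx s.
have [||w w0 [N'E wE]] := IHn N' (c - m).
- apply: leq_trans leNn; apply: proper_card; apply/properP; split.
    apply/fintype.subsetP => -[i j]; rewrite !inE !mxE /=.
    apply: contraNneq => Nij; move: (sN i); have [->|] := eqVneq (s i) j.
      by rewrite Nij ltxx.
    by rewrite Nij mulr0 subr0.
  exists (i1, s i1); rewrite inE /=; first by rewrite gt_eqF.
  by rewrite !mxE eqxx mulr1 subrr eqxx.
- have [_ rowP colP] := line_sums_perm s.
  split=> [i j|i|j].
  + rewrite !mxE; have [<-|_] := eqVneq (s i) j; last by rewrite mulr0 subr0.
    by rewrite mulr1 subr_ge0 i1min.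
  + under eq_bigr do rewrite !mxE -perm_mxE.
    by rewrite sumrB -mulr_sumr rowN rowP mulr1.
  + under eq_bigr do rewrite !mxE -perm_mxE.
    by rewrite sumrB -mulr_sumr colN colP mulr1.
exists (fun t => w t + m *+ (t == s)) => [t|].
  by rewrite addr_ge0 // mulrn_wge0 //; apply/ltW/sN.
split.
  under eq_bigr do rewrite scalerDl.
  rewrite big_split -N'E /= (bigD1 s) //= eqxx mulr1n big1 ?addr0.
    by rewrite /N' subrK.
  by move=> t /negPf ->; rewrite mulr0n scale0r.
rewrite big_split wE /= (bigD1 s) //= eqxx mulr1n big1 ?addr0 ?subrK //.
by move=> t /negPf ->.
Qed.

End BirkhoffVonNeumann.

(** * The invariant Birkhoff polytope and the cost of its points *)

Section InvariantBirkhoff.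

Variables (R : realType) (d : nat) (phi psi : {perm 'I_d}).
Hypothesis d_gt0 : (0 < d)%N.
Hypotheses (phiK : involutive phi) (psiK : involutive psi).
Implicit Types (N : 'M[R]_d) (s : {perm 'I_d}).

Definition twist N : 'M[R]_d := \matrix_(i, j) N (phi i) (psi j).
Definition symmetrize N : 'M[R]_d := 2^-1 *: (N + twist N).

Lemma line_sums_twist N c : line_sums N c -> line_sums (twist N) c.
Proof.
move=> [N0 rowN colN]; split=> [i j|i|j]; first by rewrite mxE.
  rewrite -(rowN (phi i)) [RHS](reindex_inj (@perm_inj _ psi)) /=.
  by apply: eq_bigr => j _; rewrite mxE.
rewrite -(colN (psi j)) [RHS](reindex_inj (@perm_inj _ phi)) /=.
by apply: eq_bigr => i _; rewrite mxE.
Qed.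

Lemma symmetrize_inv N : birkhoff N -> inv_birkhoff phi psi (symmetrize N).
Proof.
move=> lsN; split; last first.
  by move=> i j; rewrite !mxE phiK psiK addrC.
have h0 : 0 <= 2^-1 :> R by rewrite invr_ge0.
have := line_sums_comb h0 h0 lsN (line_sums_twist lsN).
by rewrite -scalerDr -[2^-1 * 1]mulr1 -mulrDr -(natrD _ 1 1) !mulr1 mulVf ?pnatr_eq0.
Qed.

Lemma symmetrize_id N : inv_birkhoff phi psi N -> symmetrize N = N.
Proof.
case=> _ invN; apply/matrixP => i j; rewrite !mxE -invN.
by rewrite -mulr2n -[N i j *+ 2]mulr_natl mulKf ?pnatr_eq0.
Qed.

Lemma symmetrize_sum (w : {perm 'I_d} -> R) :
  symmetrize (\sum_s w s *: perm_mx s) = \sum_s w s *: symmetrize (perm_mx s).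
Proof.
apply/matrixP => i j; rewrite /symmetrize mxE [in LHS]mxE [twist _ _ _]mxE !summxE.
rewrite -big_split mulr_sumr; apply: eq_bigr => s _ /=.
by rewrite !mxE; ring.
Qed.

(** Symmetrise the decomposition into permutation matrices. *)
Lemma inv_birkhoff_decomp N : inv_birkhoff phi psi N ->
  exists2 w : {perm 'I_d} -> R, forall s, 0 <= w s &
    N = \sum_s w s *: symmetrize (perm_mx s) /\ \sum_s w s = 1.
Proof.
move=> invN; have [bN _] := invN.
have [w w0 [NE w1]] := birkhoff_von_neumann d_gt0 bN.
by exists w => //; split=> //; rewrite -symmetrize_sum -NE symmetrize_id.
Qed.

Lemma vertex_symmetrize N : is_vertex (inv_birkhoff phi psi) N ->
  exists s, N = symmetrize (perm_mx s).
Proof.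
move=> [invN extN]; have [w w0 [NE w1]] := inv_birkhoff_decomp invN.
have [s ws] : exists s, 0 < w s.
  apply/existsP; apply: contraT; rewrite negb_exists => /forallP nw.
  have /eqP := w1; rewrite big1 ?(eq_sym 0) ?oner_eq0 // => s _.
  by apply/eqP; rewrite eq_le w0 andbT leNgt nw.
have w_le1 : w s <= 1 by rewrite -w1 (bigD1 s) //= lerDl sumr_ge0.
have [t t01 t_le] : exists2 t, 0 < t < 1 & t <= w s.
  by exists (w s / 2); [apply/andP; split|]; lra.
have t1 : 1 - t != 0 by rewrite subr_eq0 eq_sym lt_eqF //; case/andP: t01.
have [V VE] : exists V, V = symmetrize (perm_mx s) by exists (symmetrize (perm_mx s)).
have invV : inv_birkhoff phi psi V by rewrite VE; apply/symmetrize_inv/line_sums_perm.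
suff invN2 : inv_birkhoff phi psi ((1 - t)^-1 *: (N - t *: V)).
  exists s; rewrite -VE; have [] // := extN V _ t invV invN2 t01.
  by rewrite [(1 - t) *: _]scalerA mulfV // scale1r addrC subrK.
have [[N0 rowN colN] iN] := invN; have [[V0 rowV colV] iV] := invV.
have c0 : 0 <= (1 - t)^-1 by rewrite invr_ge0 subr_ge0 ltW //; case/andP: t01.
split; last by move=> i j; rewrite !mxE -iN -iV.
split=> [i j|i|j].
- rewrite mxE mulr_ge0 // !mxE subr_ge0.
  apply: (@le_trans _ _ (w s * V i j)).
    exact: ler_wpM2r.
  rewrite NE summxE (bigD1 s) //= -VE [(_ *: V) i j]mxE lerDl sumr_ge0 // => u _.
  rewrite mxE mulr_ge0 //.
  by have [[]] : inv_birkhoff phi psi (symmetrize (perm_mx u))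
    by apply/symmetrize_inv/line_sums_perm.
- under eq_bigr do rewrite !mxE.
  by rewrite -mulr_sumr sumrB -mulr_sumr rowN rowV mulr1 mulVf.
- under eq_bigr do rewrite !mxE.
  by rewrite -mulr_sumr sumrB -mulr_sumr colN colV mulr1 mulVf.
Qed.

Lemma vertex_half N i j : is_vertex (inv_birkhoff phi psi) N ->
  N i j \in [:: 0; 2^-1; 1].
Proof.
move=> /vertex_symmetrize[s ->]; rewrite /symmetrize mxE [X in _ * X]mxE.
rewrite [twist _ _ _]mxE !perm_mxE; set b := s i == j; set c := s _ == _.
case: b; case: c; rewrite ?addr0 ?add0r ?mulr1 ?mulr0 !inE ?eqxx ?orbT //.
by rewrite -mulr2n mulVf ?pnatr_eq0 // eqxx !orbT.
Qed.

Section Cost.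

Variables (alpha beta : 'I_d -> R[i]).

Lemma costD N1 N2 : cost (N1 + N2) alpha beta = cost N1 alpha beta + cost N2 alpha beta.
Proof.
rewrite /cost -mulrDr -big_split; congr (_ * _); apply: eq_bigr => i _ /=.
by rewrite -big_split; apply: eq_bigr => j _; rewrite mxE mulrDl.
Qed.

Lemma costZ t N : cost (t *: N) alpha beta = t * cost N alpha beta.
Proof.
rewrite /cost mulrCA; congr (_ * _); rewrite mulr_sumr; apply: eq_bigr => i _.
by rewrite mulr_sumr; apply: eq_bigr => j _; rewrite mxE -mulrA.
Qed.

Lemma cost_sum (w : {perm 'I_d} -> R) (V : {perm 'I_d} -> 'M[R]_d) :
  cost (\sum_s w s *: V s) alpha beta = \sum_s w s * cost (V s) alpha beta.
Proof.
have cost0 : cost 0 alpha beta = 0 by rewrite -(scale0r 0) costZ mul0r.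
rewrite (big_morph (fun N => cost N alpha beta) costD cost0).
by apply: eq_bigr => s _; rewrite costZ.
Qed.

Lemma normc_conj (z : R[i]) : Normc.normc (conjc z) = Normc.normc z.
Proof. by case: z => x y /=; rewrite sqrrN. Qed.

Lemma cost_twist N : conj_by phi alpha -> conj_by psi beta ->
  cost (twist N) alpha beta = cost N alpha beta.
Proof.
move=> ca cb; rewrite /cost; congr (_ * _).
rewrite [RHS](reindex_inj (@perm_inj _ phi)); apply: eq_bigr => i _ /=.
rewrite [RHS](reindex_inj (@perm_inj _ psi)); apply: eq_bigr => j _ /=.
by rewrite mxE -ca -cb -rmorphB /= normc_conj.
Qed.

Lemma cost_symmetrize N : conj_by phi alpha -> conj_by psi beta ->
  cost (symmetrize N) alpha beta = cost N alpha beta.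
Proof.
move=> ca cb; rewrite costZ costD cost_twist // -mulr2n -[cost N alpha beta *+ 2]mulr_natl.
by rewrite mulKf ?pnatr_eq0.
Qed.

(** The cost is invariant under the twist when the roots are permuted by complex
    conjugation, so symmetrising a minimiser over the whole Birkhoff polytope
    does not change its cost. *)
Lemma W2sq_min M : conj_by phi alpha -> conj_by psi beta ->
  unique_minimizer phi psi M alpha beta -> W2sq alpha beta = cost M alpha beta.
Proof.
move=> ca cb [invM minM]; have [bM _] := invM.
have lbM : lbound [set cost N alpha beta | N in @birkhoff R d]%classic (cost M alpha beta).
  move=> _ [N bN <-]; rewrite -(cost_symmetrize N ca cb).
  have [->//|NM] := eqVneq (symmetrize N) M.
  by apply/ltW/minM => //; apply: symmetrize_inv.
apply/eqP; rewrite eq_le; apply/andP; split; last first.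
  by apply: lb_le_inf => //; exists (cost M alpha beta), M.
by apply: ge_inf; [exists (cost M alpha beta) | exists M].
Qed.

(** Being the unique minimiser is tested against finitely many points, hence it is an
    open condition on the roots. *)
Lemma unique_minimizerP M : inv_birkhoff phi psi M ->
  (forall s, symmetrize (perm_mx s) != M ->
    cost M alpha beta < cost (symmetrize (perm_mx s)) alpha beta) ->
  unique_minimizer phi psi M alpha beta.
Proof.
move=> invM minM; split=> // N invN NM.
have [w w0 [NE w1]] := inv_birkhoff_decomp invN.
have [s wsM] : exists s, (0 < w s) && (symmetrize (perm_mx s) != M).
  apply/existsP; apply: contraNT NM; rewrite negb_exists => /forallP nw.
  rewrite NE (eq_bigr (fun s => w s *: M)); first by rewrite -scaler_suml w1 scale1r.
  move=> s _; have := nw s; rewrite negb_and negbK => /orP[ws|/eqP -> //].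
  suff -> : w s = 0 by rewrite !scale0r.
  by apply/eqP; rewrite eq_le w0 andbT leNgt.
have minMle u : cost M alpha beta <= cost (symmetrize (perm_mx u)) alpha beta.
  by have [->//|/minM/ltW] := eqVneq (symmetrize (perm_mx u)) M.
rewrite NE cost_sum -[ltLHS]mul1r -w1 mulr_suml.
case/andP: wsM => ws /minM sM.
rewrite (bigD1 s) //= [ltRHS](bigD1 s) //=; apply: ltr_leD.
  by rewrite ltr_pM2l.
by apply: ler_sum => u _; apply: ler_wpM2l.
Qed.

End Cost.

End InvariantBirkhoff.

(** * Perturbation of the roots *)

Section Perturbation.

Variables (R : realType) (d : nat).
Local Notation C := R[i].
Local Notation normc := (@Normc.normc R).

Lemma normc_ge0 (z : C) : 0 <= normc z.
Proof. by case: z => x y; apply: sqrtr_ge0. Qed.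

Lemma normc_gt0 (z : C) : z != 0 -> 0 < normc z.
Proof.
move=> z0; rewrite lt_def normc_ge0 andbT; apply: contra z0 => /eqP.
by move/Normc.eq0_normc => ->.
Qed.

Lemma normcX (z : C) n : normc (z ^+ n) = normc z ^+ n.
Proof.
elim: n => [|n IHn]; first by rewrite !expr0 Normc.normc1.
by rewrite !exprS Normc.normcM IHn.
Qed.

Lemma normc_real (x : R) : normc (real_complex R x) = `|x|.
Proof. by rewrite /= expr0n addr0 sqrtr_sqr. Qed.

Lemma normc_distC (x y : C) : normc (x - y) = normc (y - x).
Proof. by rewrite -opprB normcN. Qed.

Lemma normc_prod (I : Type) (r : seq I) (F : I -> C) :
  normc (\prod_(i <- r) F i) = \prod_(i <- r) normc (F i).
Proof. exact: (big_morph _ (@Normc.normcM R) (Normc.normc1 R)). Qed.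

Lemma normc_sum (I : Type) (r : seq I) (F : I -> C) :
  normc (\sum_(i <- r) F i) <= \sum_(i <- r) normc (F i).
Proof.
elim/big_rec2: _ => [|i y x _ le_xy]; first by rewrite Normc.normc0.
by rewrite (le_trans (le_normcD _ _)) // lerD2l.
Qed.

Lemma pos_lower_bound (I : finType) (P : pred I) (f : I -> R) :
  (forall i, P i -> 0 < f i) -> exists2 e, 0 < e & forall i, P i -> e <= f i.
Proof.
move=> f0; exists (\big[Num.min/1]_(i | P i) f i).
  by elim/big_ind: _ => // x y x0 y0; rewrite lt_min x0.
by move=> i Pi; apply: bigmin_le_cond.
Qed.

Lemma small_factor (rs : seq C) (x : C) (e : R) : 0 < e ->
  normc (\prod_(r <- rs) ('X - r%:P)).[x] < e ^+ size rs ->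
  exists2 r, r \in rs & normc (x - r) < e.
Proof.
move=> e0; rewrite horner_prod normc_prod => small.
apply/hasP; apply: contraLR small; rewrite -all_predC => /allP large.
rewrite -leNgt; elim: rs large => [|r rs IHrs] large; first by rewrite big_nil.
rewrite big_cons /= exprS; apply: ler_pM; rewrite ?exprn_ge0 ?(ltW e0) //.
  by have := large r (mem_head _ _); rewrite /= -leNgt hornerXsubC.
by apply: IHrs => u urs; apply: large; rewrite inE urs orbT.
Qed.

(** The value of [p1] at a root of [p] is small, and it is the product of the
    distances to the roots of [p1]; so some root of [p1] is close. By separation
    this gives all the roots of [p1], exactly one near each root of [p], so they
    inherit the conjugation pattern of [alpha]. *)
Lemma roots_near (p : {poly R}) (phi : {perm 'I_d}) (alpha : 'I_d -> C) (eta : R) :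
  0 < eta -> monic_deg d p -> enumerates_roots alpha p -> conj_by phi alpha ->
  exists2 delta, 0 < delta & forall p1, monic_deg d p1 ->
    (forall k, (k < d)%N -> `|p1`_k - p`_k| < delta) ->
    exists alpha1, [/\ enumerates_roots alpha1 p1, conj_by phi alpha1
      & forall i, normc (alpha1 i - alpha i) < eta].
Proof.
move=> eta0 [mp sp] [inja pE] ca.
have [|e1 e10 sep] := @pos_lower_bound ('I_d * 'I_d)%type (fun ij => ij.1 != ij.2)
  (fun ij => normc (alpha ij.1 - alpha ij.2)).
  by move=> [i j] /= ij; rewrite normc_gt0 // subr_eq0 (inj_eq inja).
pose e := Num.min eta (e1 / 2).
have e0 : 0 < e by rewrite lt_min eta0 divr_gt0.
have e_eta : e <= eta by rewrite ge_min lexx.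
have close_eq i j z : normc (z - alpha i) < e -> normc (z - alpha j) < e -> i = j.
  move=> zi zj; apply/eqP/negPn/negP => ij.
  have := sep (i, j) ij; rewrite /= leNgt => /negP; apply.
  have -> : alpha i - alpha j = (alpha i - z) + (z - alpha j).
    by rewrite addrA subrK.
  apply: (le_lt_trans (le_normcD _ _)); rewrite normc_distC.
  have : e <= e1 / 2 by rewrite ge_min lexx orbT.
  by lra.
pose S i := \sum_(k < d) normc (alpha i) ^+ k.
have S0 i : 0 <= S i by apply: sumr_ge0 => k _; rewrite exprn_ge0 // normc_ge0.
pose delta := e ^+ d / (1 + \sum_i S i).
have den0 : 0 < 1 + \sum_i S i by rewrite ltr_pwDl // sumr_ge0.
exists delta => [|p1 [mp1 sp1] close]; first by rewrite divr_gt0 // exprn_gt0.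
have [rs rsE] := closed_field_poly_normal (map_poly (real_complex R) p1).
move: rsE; rewrite (monicP _) ?monic_map // scale1r => rsE.
have srs : size rs = d.
  have := size_map_poly (real_complex R) p1.
  by rewrite rsE size_prod_XsubC sp1 => -[].
have small i : normc (map_poly (real_complex R) p1).[alpha i] < e ^+ size rs.
  have pi0 : (map_poly (real_complex R) p).[alpha i] = 0.
    by rewrite pE; apply/rootP/root_prod_XsubC_mem.
  have -> : (map_poly (real_complex R) p1).[alpha i] =
      \sum_(k < d) real_complex R (p1`_k - p`_k) * alpha i ^+ k.
    transitivity (map_poly (real_complex R) (p1 - p)).[alpha i].
      by rewrite rmorphB /= hornerD hornerN pi0 subr0.
    have s1 : (size (map_poly (real_complex R) (p1 - p)) <= d)%N.
      rewrite size_map_poly; apply/leq_sizeP => k le_dk; rewrite coefB.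
      by rewrite !(@monic_deg_coef d) // subrr.
    rewrite (horner_coef_wide _ s1); apply: eq_bigr => k _.
    by rewrite coef_map coefB.
  apply: (le_lt_trans (normc_sum _ _)).
  apply: (@le_lt_trans _ _ (delta * S i)).
    rewrite mulr_sumr; apply: ler_sum => k _.
    rewrite Normc.normcM normcX normc_real ler_wpM2r ?exprn_ge0 ?normc_ge0 //.
    by apply/ltW/close.
  rewrite srs /delta mulrAC ltr_pdivrMr // ltr_pM2l ?exprn_gt0 //.
  by rewrite ltr_pwDl // (bigD1 i) //= lerDl sumr_ge0.
have /choice[a1 a1P] i : exists r, r \in rs /\ normc (r - alpha i) < e.
  have [|r rrs near] := @small_factor rs (alpha i) e e0; first by rewrite -rsE.
  by exists r; rewrite normc_distC.
have inja1 : injective a1.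
  move=> i j eij; apply: (close_eq i j (a1 i)); first by case: (a1P i).
  by rewrite eij; case: (a1P j).
have uniq_a1 : uniq (map a1 (enum 'I_d)) by rewrite map_inj_uniq // enum_uniq.
have sub_a1 : {subset map a1 (enum 'I_d) <= rs}.
  by move=> _ /mapP[i _ ->]; case: (a1P i).
have le_rs : (size rs <= size (map a1 (enum 'I_d)))%N.
  by rewrite size_map size_enum_ord srs.
have perm_rs : perm_eq rs (map a1 (enum 'I_d)).
  rewrite perm_sym; apply: uniq_perm => //.
    exact: leq_size_uniq sub_a1 le_rs.
  by have [] := uniq_min_size uniq_a1 sub_a1 le_rs.
have p1E : map_poly (real_complex R) p1 = \prod_i ('X - (a1 i)%:P).
  by rewrite rsE (perm_big _ perm_rs) big_map /index_enum -enumT.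
exists a1; split=> //; last by move=> i; case: (a1P i) => _ /lt_le_trans; apply.
move=> i; have : root (map_poly (real_complex R) p1) (conjc (a1 i)).
  have -> : map_poly (real_complex R) p1 = map_poly conjc (map_poly (real_complex R) p1).
    by rewrite -map_poly_comp; apply: eq_map_poly => x /=; rewrite oppr0.
  rewrite /root horner_map /= p1E (rootP (root_prod_XsubC_mem a1 i)).
  by rewrite conjc_eq0.
rewrite rsE root_prod_XsubC (perm_mem perm_rs) => /mapP[j _ cj]; rewrite cj.
congr a1; apply: (close_eq j (phi i) (a1 j)); first by case: (a1P j).
by rewrite -cj -ca -rmorphB /= normc_conj; case: (a1P i).
Qed.

Lemma dist_sqr_near (x y a b : C) (eta L : R) :
  normc (a - b) <= L -> normc (x - a) < eta -> normc (y - b) < eta -> eta <= 1 ->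
  `|normc (x - y) ^+ 2 - normc (a - b) ^+ 2| <= 2 * eta * (2 * L + 2).
Proof.
move=> abL xa yb eta1.
have := normc_ge0 (x - y); have := normc_ge0 (a - b).
have le1 : normc (x - y) <= normc (a - b) + 2 * eta.
  have -> : x - y = (x - a) + ((a - b) + (b - y)) by rewrite !addrA !subrK.
  apply: (le_trans (le_normcD _ _)); have := le_normcD (a - b) (b - y).
  by rewrite (normc_distC b); lra.
have le2 : normc (a - b) <= normc (x - y) + 2 * eta.
  have -> : a - b = (a - x) + ((x - y) + (y - b)) by rewrite !addrA !subrK.
  apply: (le_trans (le_normcD _ _)); have := le_normcD (x - y) (y - b).
  by rewrite (normc_distC a); lra.
move: (normc (x - y)) (normc (a - b)) le1 le2 abL => u v le1 le2 abL v0 u0.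
rewrite subr_sqr normrM; apply: ler_pM => //.
  by rewrite ler_norml; lra.
by rewrite ger0_norm ?addr_ge0 //; lra.
Qed.

Lemma cost_near (N : 'M[R]_d) (tau : R) (alpha beta alpha1 beta1 : 'I_d -> C) :
  (0 < d)%N -> birkhoff N ->
  (forall i j, `|normc (alpha1 i - beta1 j) ^+ 2 - normc (alpha i - beta j) ^+ 2| <= tau) ->
  `|cost N alpha1 beta1 - cost N alpha beta| <= tau.
Proof.
move=> d0 [N0 rowN _] near; rewrite /cost -mulrBr normrM.
have dR : 0 < d%:R :> R by rewrite ltr0n.
rewrite ger0_norm ?invr_ge0 ?ler0n // ler_pdivrMl // -sumrB.
apply: (le_trans (ler_norm_sum _ _ _)).
apply: (@le_trans _ _ (\sum_(i < d) tau)); last first.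
  by rewrite sumr_const card_ord mulr_natl.
apply: ler_sum => i _; rewrite -sumrB -[leRHS]mul1r -(rowN i) mulr_suml.
apply: (le_trans (ler_norm_sum _ _ _)); apply: ler_sum => j _.
by rewrite -mulrBr normrM ger0_norm // ler_wpM2l.
Qed.

(** The cost is continuous in the roots, and [M] is separated by a positive gap from
    the other symmetrised permutation matrices, of which there are finitely many. *)
Lemma minimizer_near (phi psi : {perm 'I_d}) (M : 'M[R]_d) (alpha beta : 'I_d -> C) :
  (0 < d)%N -> involutive phi -> involutive psi ->
  unique_minimizer phi psi M alpha beta ->
  exists2 eta, 0 < eta & forall alpha1 beta1,
    (forall i, normc (alpha1 i - alpha i) < eta) ->
    (forall j, normc (beta1 j - beta j) < eta) ->
    unique_minimizer phi psi M alpha1 beta1.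
Proof.
move=> d0 phiK psiK [invM minM].
pose V s := symmetrize phi psi (perm_mx s : 'M[R]_d).
have invV s : inv_birkhoff phi psi (V s) by apply/symmetrize_inv/line_sums_perm.
have [|g g0 gap] := @pos_lower_bound _ (fun s => V s != M)
  (fun s => cost (V s) alpha beta - cost M alpha beta).
  by move=> s sM; rewrite subr_gt0 minM.
pose L := \sum_i \sum_j normc (alpha i - beta j).
have leL i j : normc (alpha i - beta j) <= L.
  rewrite /L (bigD1 i) //= (bigD1 j) //= -addrA lerDl addr_ge0 //.
    by apply: sumr_ge0 => k _; apply: normc_ge0.
  by apply: sumr_ge0 => k _; apply: sumr_ge0 => l _; apply: normc_ge0.
have L0 : 0 <= L by apply: sumr_ge0 => k _; apply: sumr_ge0 => l _; apply: normc_ge0.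
pose eta := Num.min 1 (g / (9 * (L + 1))).
have den0 : 0 < 9 * (L + 1) by lra.
have eta0 : 0 < eta by rewrite lt_min ltr01 divr_gt0.
have eta1 : eta <= 1 by rewrite ge_min lexx.
have etag : eta * (9 * (L + 1)) <= g.
  by rewrite -ler_pdivlMr // ge_min lexx orbT.
exists eta => // alpha1 beta1 na nb.
have near N : inv_birkhoff phi psi N ->
    `|cost N alpha1 beta1 - cost N alpha beta| <= 2 * eta * (2 * L + 2).
  move=> [bN _]; apply: cost_near => // i j; exact: dist_sqr_near.
apply: unique_minimizerP => // s sM.
have := near _ (invV s); have := near _ invM; have := gap s sM.
rewrite !ler_norml => gs /andP[m1 m2] /andP[v1 v2].
have e : 2 * eta * (2 * L + 2) = 4 * (eta * (L + 1)) by ring.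
have e' : eta * (9 * (L + 1)) = 9 * (eta * (L + 1)) by ring.
have pos : 0 < eta * (L + 1) by rewrite mulr_gt0 //; lra.
rewrite {}e in m1 m2 v1 v2; rewrite e' in etag.
by rewrite -/(V s); lra.
Qed.

End Perturbation.

(** * Approximation by polynomials with prescribed congruences *)

Section Shrink.

Variable d : nat.

Lemma monic_degP (A : nzRingType) (P : {poly A}) :
  (forall k, (d <= k)%N -> P`_k = (k == d)%:R) -> monic_deg d P.
Proof.
move=> Pk; have sP : size P = d.+1.
  apply/eqP; rewrite eqn_leq; apply/andP; split.
    by apply/leq_sizeP => k lt_dk; rewrite Pk ?(ltnW lt_dk) // gtn_eqF.
  rewrite ltnNge; apply/negP => /leq_sizeP/(_ d (leqnn d)); rewrite Pk // eqxx.
  by apply/eqP/oner_neq0.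
by split=> //; rewrite monicE lead_coefE sP /= Pk // eqxx.
Qed.

(** For [P] monic of degree [d], the monic polynomial whose roots are those of [P]
    divided by [m]. It transports integral polynomials, on which congruences
    make sense, to a dense set of rational ones. *)
Definition shrink_roots (F : fieldType) (m : F) (P : {poly F}) : {poly F} :=
  m ^- d *: (P \Po (m *: 'X)).

Lemma coef_shrink_roots (F : fieldType) (m : F) P k :
  (shrink_roots m P)`_k = m ^- d * (P`_k * m ^+ k).
Proof.
rewrite coefZ comp_polyE coef_sum; congr (_ * _).
under eq_bigr do rewrite exprZn coefZ coefZ coefXn.
have [lt_k|le_k] := ltnP k (size P).
  rewrite (bigD1 (Ordinal lt_k)) //= eqxx mulr1 big1 ?addr0 // => i.
  by rewrite -val_eqE eq_sym => /= /negPf ->; rewrite !mulr0.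
rewrite (nth_default _ le_k) mul0r big1 // => i _.
by rewrite gtn_eqF ?mulr0 // (leq_trans _ le_k).
Qed.

Lemma monic_deg_shrink (F : fieldType) (m : F) P : m != 0 -> monic_deg d P ->
  monic_deg d (shrink_roots m P).
Proof.
move=> m0 mP; apply: monic_degP => k le_dk; rewrite coef_shrink_roots.
rewrite (monic_deg_coef mP) //; case: eqP => [->|_]; last by rewrite mul0r mulr0.
by rewrite mul1r mulVf // expf_neq0.
Qed.

Lemma map_shrink_roots (F L : fieldType) (f : {rmorphism F -> L}) m P :
  map_poly f (shrink_roots m P) = shrink_roots (f m) (map_poly f P).
Proof.
apply/polyP => k; rewrite coef_map !coef_shrink_roots coef_map /=.
by rewrite !rmorphM fmorphV !rmorphXn.
Qed.

Lemma shrink_rootsVK (F : fieldType) (m : F) P : m != 0 ->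
  shrink_roots m^-1 (shrink_roots m P) = P.
Proof.
move=> m0; apply/polyP => k; rewrite !coef_shrink_roots !exprVn invrK.
by rewrite mulrA mulVKf ?mulfK // expf_neq0.
Qed.

Lemma shrink_roots_prod (F : fieldType) (m : F) P (a : 'I_d -> F) : m != 0 ->
  shrink_roots m P = \prod_i ('X - (a i)%:P) -> P = \prod_i ('X - (m * a i)%:P).
Proof.
move=> m0 Pa; rewrite -(shrink_rootsVK P m0) Pa /shrink_roots exprVn invrK.
rewrite rmorph_prod /= -[m ^+ d]/(m ^+ d) -{1}[d]card_ord -prodr_const.
rewrite -scaler_prod; apply: eq_bigr => i _.
rewrite rmorphB /= comp_polyX comp_polyC scalerBr scalerA mulfV // scale1r.
by rewrite -mul_polyC polyCM.
Qed.

(** The coefficient of degree [k] of the shrunk polynomial is that of [P] divided by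
    [m ^ (d - k)], so imposing a congruence modulo [N] costs a precision of at
    most [N / m]. *)
Lemma approx_coefs (R : realType) (p : {poly R}) (P0 : {poly int}) (N : nat) (delta : R) :
  (0 < N)%N -> monic_deg d p -> monic_deg d P0 -> 0 < delta ->
  exists K, forall m, (K < m)%N -> exists P, [/\ monic_deg d P, poly_cong N P P0
    & forall k, (k < d)%N ->
      `|(shrink_roots m%:R (map_poly intr P))`_k - p`_k| < delta].
Proof.
move=> N0 mp mP0 delta0; have NR : 0 < N%:R :> R by rewrite ltr0n.
exists (Num.bound (N%:R / delta)) => m Km.
have m_big : N%:R < m%:R * delta.
  rewrite -ltr_pdivrMr //; apply: lt_trans (archi_boundP _) _; last by rewrite ltr_nat.
  by rewrite divr_ge0 // ltW.
have m0 : 0 < m%:R :> R by rewrite ltr0n (leq_trans _ Km).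
pose x k := (p`_k * m%:R ^+ (d - k) - (P0`_k)%:~R) / N%:R.
have [P mP Pk] := monic_deg_exists d (fun k => P0`_k + N%:Z * Num.floor (x k)).
exists P; split=> // [k|k lt_kd].
  have [lt_kd|le_dk] := ltnP k d; first by rewrite Pk // addrAC subrr add0r dvdz_mulr.
  by rewrite !(@monic_deg_coef d) // subrr dvdz0.
rewrite coef_shrink_roots coef_map /= Pk //.
set c := Num.floor (x k); set y := p`_k; pose t : R := m%:R ^+ (d - k).
have t0 : 0 < t by rewrite exprn_gt0.
have tE : m%:R ^- d * m%:R ^+ k = t^-1 :> R.
  rewrite /t -{1}(subnK (ltnW lt_kd)) exprD invfM -mulrA mulVf ?mulr1 //.
  by rewrite expf_neq0 // gt_eqF.
rewrite mulrCA tE.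
have -> : (P0`_k + N%:Z * c)%:~R / t - y =
    N%:R * (c%:~R - x k) / t.
  have xE : N%:R * x k = y * t - (P0`_k)%:~R by rewrite mulrC divfK // gt_eqF.
  rewrite intrD intrM -pmulrn mulrBr xE; field; exact: lt0r_neq0.
have /andP[c1 c2] := floor_itv (x k).
rewrite normrM normrM [`|t^-1|]gtr0_norm ?invr_gt0 // ltr_pdivrMr //.
rewrite [`|N%:R|]gtr0_norm //.
have cx : `|c%:~R - x k| <= 1.
  by rewrite intrD in c2; rewrite ler_norml; rewrite -/c in c1 c2; lra.
apply: (@le_lt_trans _ _ N%:R); first by rewrite -[leRHS]mulr1 ler_wpM2l // ltW.
apply: (lt_le_trans m_big); rewrite mulrC ler_wpM2l ?(ltW delta0) // /t.
rewrite -(prednK (n := d - k)) ?subn_gt0 // exprS ler_peMr ?(ltW m0) // exprn_ege1 //.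
by rewrite ler1n (leq_trans _ Km).
Qed.

End Shrink.

(** * The orbit polynomial at a pair with full symmetry *)

Section CostValue.

Variables (R : realType) (d : nat) (phi psi : {perm 'I_d}) (M : 'M[R]_d).
Hypothesis M_half : forall i j, M i j \in [:: 0; 2^-1; 1].

Lemma normc_sqr (z : R[i]) : real_complex R (Normc.normc z ^+ 2) = z * conjc z.
Proof.
case: z => x y; rewrite /= sqr_sqrtr ?addr_ge0 ?sqr_ge0 //.
by rewrite /real_complex_def; congr (_ +i* _)%C; ring.
Qed.

Lemma cost_eq_f_poly (alpha beta : 'I_d -> R[i]) :
  conj_by phi alpha -> conj_by psi beta ->
  real_complex R (cost M alpha beta) = mmap ratr (pt alpha beta) (f_poly phi psi M).
Proof.
move=> ca cb; rewrite f_polyE mmapZ mmap_ratr_int mmap_cost_form.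
rewrite /cost rmorphM fmorphV rmorph_nat rmorphM !fmorphV !rmorph_nat -mulrA.
congr (_ * _); rewrite mulr_sumr rmorph_sum; apply: eq_bigr => i _ /=.
rewrite mulr_sumr rmorph_sum; apply: eq_bigr => j _ /=.
rewrite rmorphM /= normc_sqr rmorphB /= ca cb; set Z := (alpha i - beta j) * _.
rewrite -[Z *+ _]mulr_natl [RHS]mulrA; congr (_ * _).
have -> : (mult M i j)%:R = real_complex R (2 * M i j).
  by rewrite -(multE M_half) rmorph_nat.
by rewrite rmorphM rmorph_nat mulKf ?pnatr_eq0.
Qed.

End CostValue.

Section Scaling.

Variable d : nat.
Local Notation G := ({perm 'I_d} * {perm 'I_d})%type.

(** Rescale the variables of a relation. *)
Lemma rational_symmetry_scale (K : numFieldType) (m : nat) (a b : 'I_d -> K) (g : G) :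
  (0 < m)%N ->
  rational_symmetry (fun i => m%:R * a i) (fun j => m%:R * b j) g ->
  rational_symmetry a b g.
Proof.
move=> m0 sym S.
pose S' : mpoly (d + d) rat :=
  mmap (@mpolyC (d + d) rat) (fun k => mpolyC _ m%:R^-1 * mpolyX _ (mnm1 k)) S.
have S'E (x y : 'I_d -> K) : mmap ratr (pt (fun i => m%:R * x i) (fun j => m%:R * y j)) S' =
    mmap ratr (pt x y) S.
  rewrite /S' (rmorph_mmap _ (mmap ratr _)); apply: eq_mmap => [c|k] /=.
    by rewrite mmapC.
  rewrite rmorphM /= mmapC mmapXU /= fmorphV rmorph_nat /pt.
  by case: (fintype.split k) => i; rewrite mulKf // pnatr_eq0 -lt0n.
by rewrite -S'E => /sym; rewrite (@eq_mmap_pt _ _ _ _ _ _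
  (fun i => m%:R * (a \o g.1) i) (fun j => m%:R * (b \o g.2) j)) // S'E.
Qed.

End Scaling.

Lemma act_map_mpoly (d : nat) (A B : comNzRingType) (r : {rmorphism A -> B})
    (g : {perm 'I_d} * {perm 'I_d}) P : act g (map_mpoly r P) = map_mpoly r (act g P).
Proof.
apply: (@eq_rmorph_blocks _ _ _ (act g \o map_mpoly r) (map_mpoly r \o act g))
  => [c|i|j] /=.
- by rewrite actC !map_mpolyC actC.
- by rewrite actXl !map_mpolyX actXl.
- by rewrite actXr !map_mpolyX actXr.
Qed.

Lemma act_rcoset (d : nat) (B : comNzRingType) (H : {group {perm 'I_d} * {perm 'I_d}})
    (P : mpoly (d + d) B) (C : {set {perm 'I_d} * {perm 'I_d}}) x :
  (forall g, g \in H -> act g P = P) -> C \in rcosets H [set: _] -> x \in C ->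
  act x P = @act d _ (repr C) P.
Proof.
move=> stabH /rcosetsP[y _ ->] xC.
have yC := mem_repr_rcoset H y; move: (repr _) yC => z zC.
have act_y u : u \in (H :* y)%g -> act u P = act y P.
  by case/rcosetP => v vH ->; rewrite actM stabH.
by rewrite (act_y x xC) (act_y z zC).
Qed.

Lemma prod_rcosets_invariant (d : nat) (B : comNzRingType)
    (H : {group {perm 'I_d} * {perm 'I_d}})
    (Q : {perm 'I_d} * {perm 'I_d} -> mpoly (d + d) B) :
  (forall u g, act u (Q g) = Q (g * u)%g) ->
  (forall (C : {set {perm 'I_d} * {perm 'I_d}}) x,
    C \in rcosets H [set: _] -> x \in C -> Q x = Q (repr C)) ->
  act_invariant (\prod_(C in rcosets H [set: _]) Q (repr C)).
Proof.
move=> actQ QC u; rewrite rmorph_prod [RHS](reindex_inj (can_inj (rcosetK u))) /=.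
have cosetM (C : {set {perm 'I_d} * {perm 'I_d}}) :
    ((C :* u)%g \in rcosets H [set: _]) = (C \in rcosets H [set: _]).
  apply/rcosetsP/rcosetsP => -[y _].
    by move=> Cu; exists (y * u^-1)%g; rewrite ?inE // rcosetM -Cu rcosetK.
  by move=> ->; exists (y * u)%g; rewrite ?inE // rcosetM.
apply: eq_big => [C|C cC]; first by rewrite cosetM.
rewrite actQ; apply: QC; first by rewrite cosetM.
rewrite mem_rcoset mulgK; case/rcosetsP: cC => y _ ->.
exact: (mem_repr_rcoset H y).
Qed.

Section Orbit.

Variables (R : realType) (d : nat) (phi psi : {perm 'I_d}) (M : 'M[R]_d).
Local Notation G := ({perm 'I_d} * {perm 'I_d})%type.
Hypothesis d_gt0 : (0 < d)%N.
Hypotheses (phiK : involutive phi) (psiK : involutive psi).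
Hypothesis M_birk : inv_birkhoff phi psi M.
Hypothesis M_half : forall i j, M i j \in [:: 0; 2^-1; 1].
Local Notation F := (cost_form phi psi (mult M)).
Local Notation f := (f_poly phi psi M).
Local Notation cosets := (rcosets (Aut_iota phi psi M) [set: G]).
Let A := Aut_iota_Group phiK psiK M_birk M_half.

Lemma stabilizer_f (g : G) : g \in Aut_iota phi psi M -> act g f = f.
Proof.
move=> /(stabilizerP phiK psiK M_birk M_half) gF.
by rewrite f_polyE -mul_mpolyC rmorphM /= actC act_map_mpoly gF.
Qed.

Lemma act_coset (C : {set G}) (x : G) : C \in cosets -> x \in C ->
  act x f = @act d _ (repr C) f.
Proof. exact: (act_rcoset (H := A) stabilizer_f). Qed.

Lemma mem_coset1 : (A :* 1)%g \in cosets.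
Proof. by apply/rcosetsP; exists 1%g; rewrite ?inE. Qed.

Lemma card_cosets : (#|cosets| * #|Aut_iota phi psi M|)%N = (d`! ^ 2)%N.
Proof.
have := Lagrange (finset.subsetT A); rewrite mulnC /= => ->.
by rewrite cardsT card_prod card_Sn.
Qed.

Section Values.

Variables (alpha beta : 'I_d -> R[i]) (p q : {poly rat}).
Hypothesis pE : map_poly ratr p = \prod_i ('X - (alpha i)%:P).
Hypothesis qE : map_poly ratr q = \prod_j ('X - (beta j)%:P).

Definition value (g : G) : R[i] := mmap ratr (pt alpha beta) (act g f).

Lemma Phi_h_poly : Phi alpha beta (h_poly phi psi M) =
  \prod_(C in cosets) ((value (repr C))%:P - 'X).
Proof.
transitivity (map_poly (mmap (@ratr R[i]) (pt alpha beta)) (h_poly phi psi M)) => //.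
rewrite /h_poly rmorph_prod; apply: eq_bigr => C _ /=.
by rewrite rmorphB /= map_polyX map_polyC.
Qed.

Lemma h_poly_rational : exists H : {poly rat},
  map_poly ratr H = Phi alpha beta (h_poly phi psi M).
Proof.
pose S : mpoly (d + d) {poly rat} :=
  \prod_(C in cosets) (map_mpoly polyC (@act d _ (repr C) f) - mpolyC _ 'X).
have invS : act_invariant S.
    apply: (prod_rcosets_invariant (H := A)
    (Q := fun g => map_mpoly polyC (act g f) - mpolyC _ 'X)) => [u g|C x cC xC].
    by rewrite rmorphB /= actC act_map_mpoly actM.
  by rewrite (act_coset cC xC).
have [H HE] := invariant_transfer (map_poly polyC p) (map_poly polyC q) invS.
exists H; rewrite Phi_h_poly.
rewrite -(HE _ (map_poly ratr) _ _ (map_map_polyC pE) (map_map_polyC qE)).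
rewrite rmorph_prod; apply: eq_bigr => C _ /=.
rewrite rmorphB /= mmapC /= map_polyX; congr (_ - _).
by rewrite mmap_pt_polyC.
Qed.

Hypothesis sym : forall g : G, rational_symmetry alpha beta g.
Hypothesis sep : separates_orbit F alpha beta.

Lemma value_inj : {in cosets &, injective (fun C : {set G} => value (repr C))}.
Proof.
have valueE g : value g = ratr (d%:R^-1 / 2) * mmap intr (pt alpha beta) (act g F).
  rewrite /value f_polyE -mul_mpolyC rmorphM /= actC rmorphM /= mmapC.
  by rewrite act_map_mpoly mmap_ratr_int.
have c0 : ratr (d%:R^-1 / 2) != 0 :> R[i].
  by rewrite fmorph_eq0 mulf_neq0 ?invr_eq0 ?pnatr_eq0 // -lt0n.
have injV g h : value g = value h -> act g F = act h F.
  rewrite !valueE => /(mulfI c0) egh; apply/eqP/negPn/negP => /sep/negP.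
  by apply; apply/eqP.
by move=> C D cC cD /injV; apply: (act_repr_inj phiK psiK M_birk M_half cC cD).
Qed.

(** The relation saying that [r] vanishes at the value of [g] is transported by the
    rational symmetry [g^-1 * h]. *)
Lemma root_value (r : {poly rat}) (g h : G) :
  root (map_poly ratr r) (value g) -> root (map_poly ratr r) (value h).
Proof.
move=> /rootP; rewrite /value -mmap_horner => /(sym (g^-1 * h)%g).
rewrite mmap_horner => rg; apply/rootP; rewrite -[RHS]rg.
by rewrite -mmap_act -actM mulKVg.
Qed.

Variable H : {poly rat}.
Hypothesis HE : map_poly ratr H = Phi alpha beta (h_poly phi psi M).

Lemma root_H z : root (map_poly ratr H) z -> exists g, z = value g.
Proof.
rewrite HE Phi_h_poly /root horner_prod => /prodf_eq0[C _].
rewrite hornerD hornerN hornerC hornerX subr_eq0 => /eqP <-.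
by exists (repr C).
Qed.

Lemma value_root_H g : root (map_poly ratr H) (value g).
Proof.
suff : root (map_poly ratr H) (value (repr (A :* 1)%g)) by apply: root_value.
rewrite HE Phi_h_poly /root horner_prod; apply/prodf_eq0.
exists (A :* 1)%g; first exact: mem_coset1.
by rewrite hornerD hornerN hornerC hornerX subrr.
Qed.

(** The roots are simple because distinct cosets have distinct values. *)
Lemma H_split : exists2 rs : seq R[i], uniq rs /\ size rs = #|cosets| &
  map_poly ratr H %= \prod_(z <- rs) ('X - z%:P) /\ forall z, z \in rs -> exists g, z = value g.
Proof.
exists [seq value (repr C) | C : {set G} in cosets].
  split; first by apply/dinjectiveP; apply: value_inj.
  by rewrite size_image.
split; last by move=> z /mapP[C _ zE]; exists (repr C).
rewrite HE Phi_h_poly big_image /=.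
have -> : \prod_(C in cosets) ((value (repr C))%:P - 'X) =
    (-1) ^+ #|cosets| *: \prod_(C in cosets) ('X - (value (repr C))%:P).
  rewrite -prodr_const -scaler_prod; apply: eq_bigr => C _.
  by rewrite scaleN1r opprB.
by apply: eqp_scale; rewrite signr_eq0.
Qed.

Lemma size_H : size H = #|cosets|.+1.
Proof.
have [rs [_ srs] [Hrs _]] := H_split.
by rewrite -(size_map_poly (@ratr R[i])) (eqp_size Hrs) size_prod_XsubC srs.
Qed.

Lemma H_dvd (r : {poly rat}) g : root (map_poly ratr r) (value g) -> H %| r.
Proof.
move=> rg; have [rs [urs _] [Hrs rsV]] := H_split.
rewrite -(dvdp_map (@ratr R[i])) (eqp_dvdl _ Hrs); apply: uniq_roots_dvdp.
  by apply/allP => z /rsV[h ->]; apply: root_value rg.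
by rewrite uniq_rootsE.
Qed.

Lemma H_irreducible : irreducible_poly H.
Proof.
have H0 : H != 0 by rewrite -size_poly_eq0 size_H.
split.
  rewrite size_H ltnS card_gt0; apply/finset.set0Pn; exists (A :* 1)%g.
  exact: mem_coset1.
move=> r r1 rH; have : size (map_poly (@ratr R[i]) r) != 1 by rewrite size_map_poly.
case/closed_rootP => z rz.
have [g zE] : exists g, z = value g.
  apply: root_H; move: rz; rewrite -!dvdp_XsubCl => /dvdp_trans; apply.
  by rewrite dvdp_map.
by rewrite /eqp rH; apply: (H_dvd (g := g)); rewrite -zE.
Qed.

Lemma H_degree (w : R) : real_complex R w = value 1%g -> algebraic_degree w #|cosets|.
Proof.
move=> wE; have H0 : H != 0 by rewrite -size_poly_eq0 size_H.
have lH : (lead_coef H)^-1 != 0 by rewrite invr_eq0 lead_coef_eq0.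
have rootw (r : {poly rat}) : root (map_poly ratr r) w = root (map_poly ratr r) (value 1%g).
  rewrite -wE -(fmorph_root (real_complex R)) -map_poly_comp.
  by congr (root _ _); apply: eq_map_poly => c /=; rewrite fmorph_rat.
exists ((lead_coef H)^-1 *: H); last by rewrite size_scale ?size_H.
split.
- by rewrite monicE lead_coefZ mulVf // lead_coef_eq0.
- by rewrite map_polyZ /= rootZ ?fmorph_eq0 // rootw value_root_H.
by move=> r; rewrite rootw dvdpZl // => /H_dvd.
Qed.

End Values.

End Orbit.

(** * Density of the pairs that satisfy a congruence *)

Section Density.

Variables (R : realType) (d : nat) (phi psi : {perm 'I_d}) (M : 'M[R]_d).
Hypothesis d_gt0 : (0 < d)%N.
Hypotheses (phiK : involutive phi) (psiK : involutive psi).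

Variables (N : nat) (P0 Q0 : {poly int}).
Hypotheses (N_gt0 : (0 < N)%N) (P0_monic : monic_deg d P0) (Q0_monic : monic_deg d Q0).

Definition rational_shrink (m : nat) (P : {poly int}) : {poly rat} :=
  shrink_roots d m%:R (map_poly intr P).

Lemma monic_deg_intr (K : nzRingType) (P : {poly int}) :
  monic_deg d P -> monic_deg d (map_poly intr P : {poly K}).
Proof.
move=> mP; apply: monic_degP => k le_dk; rewrite coef_map (monic_deg_coef mP) //=.
exact: rmorph_nat.
Qed.

Lemma map_rational_shrink (K : numFieldType) m P :
  map_poly ratr (rational_shrink m P) = shrink_roots d m%:R (map_poly intr P) :> {poly K}.
Proof.
rewrite map_shrink_roots rmorph_nat -map_poly_comp; congr shrink_roots.
by apply: eq_map_poly => c /=; rewrite ratr_int.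
Qed.

Definition congruent_pairs : set ({poly R} * {poly R}) :=
  [set pq | UM phi psi M pq /\ exists m P Q,
    [/\ (0 < m)%N, poly_cong N P P0, poly_cong N Q Q0,
        pq.1 = map_poly ratr (rational_shrink m P)
      & pq.2 = map_poly ratr (rational_shrink m Q)]]%classic.

(** Both conditions that define [UM] are open: the enumeration of the roots follows
    the coefficients, and the minimiser is stable. *)
Lemma UM_near (p q : {poly R}) : UM phi psi M (p, q) ->
  exists2 delta, 0 < delta & forall p1 q1, monic_deg d p1 -> monic_deg d q1 ->
    (forall k, (k < d)%N -> `|p1`_k - p`_k| < delta) ->
    (forall k, (k < d)%N -> `|q1`_k - q`_k| < delta) -> UM phi psi M (p1, q1).
Proof.
case=> /= mp sp mq sq [alpha [beta [pE qE ca cb minM]]].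
have [eta eta0 near_min] := minimizer_near d_gt0 phiK psiK minM.
have [dp dp0 near_p] := roots_near eta0 (conj mp sp) pE ca.
have [dq dq0 near_q] := roots_near eta0 (conj mq sq) qE cb.
exists (Num.min dp dq) => [|p1 q1 mp1 mq1 pp1 qq1]; first by rewrite lt_min dp0.
have [|alpha1 [p1E ca1 na]] := near_p p1 mp1.
  by move=> k /pp1; rewrite lt_min => /andP[].
have [|beta1 [q1E cb1 nb]] := near_q q1 mq1.
  by move=> k /qq1; rewrite lt_min => /andP[].
have [[? ?] [? ?]] := (mp1, mq1); split=> //=.
by exists alpha1, beta1; split=> //; apply: near_min.
Qed.

Lemma congruent_pairs_dense : dense_in d congruent_pairs (UM phi psi M).
Proof.
split=> [pq [] //|_ [[p q] pqU <-] B /nbhs_ballP[e /= e0 eB]].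
have [delta delta0 nearU] := UM_near pqU.
have [/= mp sp mq sq _] := pqU.
pose eps := Num.min delta e.
have eps0 : 0 < eps by rewrite lt_min delta0.
have [Kp apxp] := approx_coefs N_gt0 (conj mp sp) P0_monic eps0.
have [Kq apxq] := approx_coefs N_gt0 (conj mq sq) Q0_monic eps0.
pose m := (Kp + Kq).+1.
have [P [mP PP0 Pnear]] := apxp m (leq_addr _ _).
have [Q [mQ QQ0 Qnear]] := apxq m (leq_addl _ _).
pose p1 : {poly R} := map_poly ratr (rational_shrink m P).
pose q1 : {poly R} := map_poly ratr (rational_shrink m Q).
have m0 : m%:R != 0 :> R by rewrite pnatr_eq0.
have p1U : UM phi psi M (p1, q1).
  apply: nearU; rewrite /p1 /q1 ?map_rational_shrink.
  - exact/monic_deg_shrink/monic_deg_intr.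
  - exact/monic_deg_shrink/monic_deg_intr.
  - by move=> k /Pnear; rewrite lt_min => /andP[].
  - by move=> k /Qnear; rewrite lt_min => /andP[].
exists (coef_pair d (p1, q1)); split.
  exists (p1, q1) => //; split=> //; exists m, P, Q.
  by split.
apply: eB; split=> // i k; rewrite /coef_pair !mxE -ball_normE /= distrC.
case: (fintype.split k) => j; rewrite !mxE.
  have := Pnear j (ltn_ord j); rewrite lt_min => /andP[_].
  by rewrite /p1 map_rational_shrink.
have := Qnear j (ltn_ord j); rewrite lt_min => /andP[_].
by rewrite /q1 map_rational_shrink.
Qed.

End Density.

Local Open Scope classical_set_scope.

Theorem theorem4p6 (R : realType) (d : nat) (phi psi : {perm 'I_d})
    (M : 'M[R]_d) (hd : (0 < d)%N)
    (hphi : involutive phi) (hpsi : involutive psi)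
    (hM : is_vertex (inv_birkhoff phi psi) M) :
  exists U : set ({poly R} * {poly R}),
    [/\ dense_in d U (UM phi psi M),
        forall p q, U (p, q) -> is_rational p /\ is_rational q
      & forall p q, U (p, q) ->
        forall alpha beta, admissible phi psi M p q alpha beta ->
          (exists2 H : {poly rat},
             map_poly ratr H = Phi alpha beta (h_poly phi psi M) &
             irreducible_poly H) /\
          (exists2 n : nat, algebraic_degree (W2sq alpha beta) n &
             n%:R = (d`! ^ 2)%:R / #|Aut_iota phi psi M|%:R :> rat)].
Proof.
have M_half i j : M i j \in [:: 0; 2^-1; 1] by apply: vertex_half hM.
have [invM _] := hM.
have [N N0 [P0 [Q0 [mP0 mQ0 special]]]] :=
  special_pairs (cost_form phi psi (mult M)).
exists (congruent_pairs phi psi M N P0 Q0); split.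
- exact: congruent_pairs_dense.
- move=> p q [_ [m [P [Q [_ _ _ /= -> ->]]]]].
  by split; [exists (rational_shrink d m P) | exists (rational_shrink d m Q)].
move=> p q [_ [m [P [Q [m0 PP0 QQ0 /= pE qE]]]]] alpha beta.
move=> [[_ alphaE] [_ betaE] ca cb minM].
have toC (s : {poly rat}) :
    map_poly (real_complex R) (map_poly ratr s) = map_poly ratr s :> {poly R[i]}.
  by rewrite -map_poly_comp; apply: eq_map_poly => c /=; rewrite fmorph_rat.
rewrite {}pE toC in alphaE; rewrite {}qE toC in betaE.
have mC : m%:R != 0 :> R[i] by rewrite pnatr_eq0 -lt0n.
have PE := alphaE; have QE := betaE.
rewrite !map_rational_shrink in PE QE.
have [] := special P Q PP0 QQ0 _ _ _ (shrink_roots_prod mC PE) (shrink_roots_prod mC QE).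
move=> symm sepm.
have sym g : rational_symmetry alpha beta g.
  exact: rational_symmetry_scale m0 (symm g).
have sep : separates_orbit (cost_form phi psi (mult M)) alpha beta.
  move=> g h /sepm; apply: contraNneq => egh.
  have scale u : mmap intr (pt (fun i => m%:R * alpha i) (fun j => m%:R * beta j))
      (act u (cost_form phi psi (mult M))) =
      m%:R ^+ 2 * mmap intr (pt alpha beta) (act u (cost_form phi psi (mult M))).
    rewrite [in RHS]mmap_act -mmap_cost_form_scale mmap_act.
    exact: eq_mmap_pt.
  have escale := congr1 (fun z : R[i] => m%:R ^+ 2 * z) egh.
  by apply/eqP; exact: etrans (scale g) (etrans escale (esym (scale h))).
have [H HE] := h_poly_rational hphi hpsi invM M_half alphaE betaE.
split; first by exists H => //; exact: (H_irreducible hd hphi hpsi invM M_half sym sep HE).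
have coset_card := card_cosets hphi hpsi invM M_half.
exists #|rcosets (Aut_iota phi psi M) [set: {perm 'I_d} * {perm 'I_d}]%SET|.
  apply: (H_degree hd hphi hpsi invM M_half sym sep HE).
  rewrite /value act1 -(cost_eq_f_poly M_half ca cb).
  by rewrite (W2sq_min hphi hpsi ca cb minM).
rewrite -coset_card natrM mulfK // pnatr_eq0; apply/eqP => A0.
move/esym/eqP: coset_card; rewrite A0 muln0 expn_eq0 andbT.
by rewrite eqn0Ngt fact_gt0.
Qed.
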